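(* (Polynomial Affection Principle) Let $\Gamma$ be a finite connected loose graph, let $xy$ be an edge on the (distinct) vertices $x$ and $y$, and let $k$ be any finite field. Then in $K_0(\mathrm{Sch}_k)$ we have $$\mathbb P(\Gamma)-\mathbb P(\Gamma_{xy})=\mathbb P(\Gamma_{|\mathbf P_{x,y}})-\mathbb P({\Gamma_{xy}}_{|\mathbf P_{x,y}}).$$
   Context: A loose graph is a triple $(V,E,\mathbf I)$ of vertices, edges and a symmetric incidence relation between vertices and edges such that each edge is incident with at most two distinct vertices (so an edge may have two, one or no vertices); no loops, undirected. Ambient space: let $\overline\Gamma$ be the graph obtained from $\Gamma$ by adding a second, new vertex to each edge having only one vertex (and two new vertices to each edge having none), with vertex set $\overline V$; $\mathbf P(\Gamma)\otimes_{\mathbb F_1}k$ is the projective space over $k$ with one homogeneous coordinate $X_w$ for each $w\in\overline V$. For $v\in V$, $\mathbb A_v$ is the affine space of dimension $\deg(v)$ given by $X_v\ne0$ and $X_w=0$ for every $w\in\overline V\setminus\{v\}$ not adjacent to $v$ in $\overline\Gamma$. An edge with no vertices gives a multiplicative group (both added-end coordinates nonzero, all others $0$). $\mathcal F(\Gamma)\otimes_{\mathbb F_1}k$ is the union of all these pieces. $K_0(\mathrm{Sch}_k)$ is the Grothendieck ring of schemes of finite type over $k$, $\mathbb L$ is the class of the affine line, and the Grothendieck polynomial $\mathbb P(\Gamma)$ is the class of $\mathcal F(\Gamma)\otimes_{\mathbb F_1}k$, a polynomial in $\mathbb L$ with integer coefficients independent of $k$; substituting $q$ for $\mathbb L$ gives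 the number of $\mathbb F_q$-rational points of $\mathcal F(\Gamma)\otimes_{\mathbb F_1}\mathbb F_q$. Resolution: $\Gamma_{xy}$ is the loose graph obtained from $\Gamma$ by deleting the edge $xy$ and adding two new loose edges, one incident only with $x$ and one incident only with $y$. With $\mathrm d$ the graph distance in $\Gamma$ and $\overline{\mathbf B}(c,1)=\{v\in V\mid\mathrm d(c,v)\le1\}$, $\mathbf P_{x,y}$ is the projective space generated by $\overline{\mathbf B}(x,1)\cup\overline{\mathbf B}(y,1)$ (distances taken in $\Gamma$), and $\Gamma_{|\mathbf P_{x,y}}$ is the graph induced by $\Gamma$ on these vertices; ${\Gamma_{xy}}_{|\mathbf P_{x,y}}$ is the loose graph induced by $\Gamma_{xy}$ on the same vertices, including the two new loose edges at $x$ and $y$. *)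

(* Defs.v *)
From HB Require Import structures.
From mathcomp Require Import all_boot all_order all_algebra.
From mathcomp Require Import boolp.
From Stdlib Require Import ClassicalEpsilon.

Set Implicit Arguments.
Unset Strict Implicit.
Unset Printing Implicit Defensive.

Import GRing.Theory.
Local Open Scope ring_scope.

Local Obligation Tactic := idtac.

(* Vertices and edges live in different types, so a vertex-edge relation
   [inc] carries the same data as a symmetric incidence relation. *)
Record loose_graph := LooseGraph {
  vert : finType;
  edge : finType;
  inc : vert -> edge -> bool;
  inc_le2 : forall e, (#|[set v | inc v e]| <= 2)%N }.

Definition ends (G : loose_graph) (e : edge G) : {set vert G} :=
  [set v | inc v e].

Definition adj (G : loose_graph) : rel (vert G) :=
  fun v w => (v != w) && [exists e, inc v e && inc w e].

Definition incidence (G : loose_graph) : rel (vert G + edge G)%type :=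
  fun a b => match a, b with
             | inl v, inr e | inr e, inl v => inc v e
             | _, _ => false
             end.

(* Paths run through vertices and edges, so that an edge without vertices is a
   connected component. *)
Definition loose_connected (G : loose_graph) : Prop :=
  forall a b : vert G + edge G, connect (@incidence G) a b.

(* The least length of a path from [c] to [v]; the value is #|V| when there is
   no path, and shortest paths have length < #|V|. *)
Definition dist (G : loose_graph) (c v : vert G) : nat :=
  \big[minn/#|vert G|]_(n < #|vert G| |
     [exists s : n.-tuple (vert G), path (@adj G) c s && (last c s == v)]) n.

Definition closed_ball (G : loose_graph) (c : vert G) (r : nat) :
  {set vert G} := [set v | (dist c v <= r)%N].

(* An edge [e] with d < 2 vertices receives the new vertices (e, i), for i < 2 - d. *)
Definition new_vert (G : loose_graph) : finType :=
  {p : edge G * 'I_2 | (#|ends p.1| + p.2 < 2)%N}.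

Definition completion_inc (G : loose_graph) (v : vert G + new_vert G)
    (e : edge G) : bool :=
  match v with inl v => inc v e | inr p => (val p).1 == e end.

Lemma completion_le2 (G : loose_graph) (e : edge G) :
  (#|[set v | @completion_inc G v e]| <= 2)%N.
Proof.
set A := [set v | _].
have inj_f : {in A &, injective (fun v : vert G + new_vert G =>
    match v with
    | inl v => (index v (enum (ends e)))
    | inr p => (#|ends e| + (val p).2)%N end)}.
  have ltE v : inc v e -> (index v (enum (ends e)) < #|ends e|)%N.
    by move=> ve; rewrite cardE index_mem mem_enum inE.
  move=> [v|p] [w|q]; rewrite !inE /=.
  - move=> ve we eq_i; congr inl.
    have vE : v \in enum (ends e) by rewrite mem_enum inE.
    have wE : w \in enum (ends e) by rewrite mem_enum inE.
    by rewrite -(nth_index v vE) eq_i nth_index.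
  - by move=> /ltE lt_v _ E; rewrite E ltnNge leq_addr in lt_v.
  - by move=> _ /ltE lt_v E; rewrite -E ltnNge leq_addr in lt_v.
  - move=> /eqP pe /eqP qe /addnI pq; congr inr; apply: val_inj => /=.
    rewrite (surjective_pairing (val p)) (surjective_pairing (val q)) pe qe.
    by rewrite (val_inj pq).
rewrite cardE -(size_map (fun v : vert G + new_vert G =>
    match v with
    | inl v => (index v (enum (ends e)))
    | inr p => (#|ends e| + (val p).2)%N end)).
rewrite -[X in (_ <= X)%N](size_iota 0 2); apply: uniq_leq_size.
  rewrite map_inj_in_uniq ?enum_uniq // => v w; rewrite !mem_enum; exact: inj_f.
move=> n /mapP[v]; rewrite mem_enum inE mem_iota /= add0n => ve ->.
case: v ve => [v|p] /=.
  move=> ve; apply: leq_trans (inc_le2 e).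
  by rewrite -/(ends e) cardE index_mem mem_enum inE.
by move/eqP=> <-; exact: (valP p).
Qed.

Definition completion (G : loose_graph) : loose_graph :=
  LooseGraph (@completion_le2 G).

Definition old_vert (G : loose_graph) (v : vert G) : vert (completion G) :=
  inl v.

Definition resolve_inc (G : loose_graph) (xy : edge G) (x y : vert G)
    (v : vert G) (e : {e : edge G | e != xy} + bool) : bool :=
  match e with
  | inl e => inc v (val e)
  | inr b => v == (if b then x else y)
  end.

Lemma resolve_le2 (G : loose_graph) (xy : edge G) (x y : vert G)
    (e : {e : edge G | e != xy} + bool) :
  (#|[set v | resolve_inc x y v e]| <= 2)%N.
Proof.
case: e => [e|b] /=; first exact: inc_le2.
by rewrite (_ : [set v | _] = [set if b then x else y]) ?cards1 //;
   apply/setP=> v; rewrite !inE.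
Qed.

(* The edge [xy] is replaced with the loose edges [inr true] at [x] and
   [inr false] at [y]. *)
Definition resolve (G : loose_graph) (xy : edge G) (x y : vert G) :
  loose_graph := LooseGraph (@resolve_le2 G xy x y).

(* The edges of the loose graph induced on [W] are those having at least one
   vertex and all of whose vertices are in [W]: this includes the loose edges
   at vertices of [W]. *)
Definition induced_edge (G : loose_graph) (W : {set vert G}) : finType :=
  {e : edge G | (ends e != set0) && (ends e \subset W)}.

Definition induced_inc (G : loose_graph) (W : {set vert G})
    (v : {v : vert G | v \in W}) (e : induced_edge W) : bool :=
  inc (val v) (val e).

Lemma induced_le2 (G : loose_graph) (W : {set vert G}) (e : induced_edge W) :
  (#|[set v | induced_inc v e]| <= 2)%N.
Proof.
rewrite -(card_imset _ (@val_inj _ _ {v : vert G | v \in W})).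
apply: leq_trans (inc_le2 (val e)); apply: subset_leq_card.
by apply/subsetP=> _ /imsetP[v ve ->]; rewrite !inE in ve *.
Qed.

Definition induced (G : loose_graph) (W : {set vert G}) : loose_graph :=
  LooseGraph (@induced_le2 G W).

(* The vertices of [G] generating the projective space P_{x,y}. *)
Definition Pxy (G : loose_graph) (x y : vert G) : {set vert G} :=
  closed_ball x 1 :|: closed_ball y 1.

Arguments Pxy : clear implicits.

(* Functors of points. [comAlgType k] only contains nonzero algebras. A Zariski sheaf takes a
   one-point value on the zero algebra, so nothing is lost. *)
Record functor (k : fieldType) := Functor {
  points :> comAlgType k -> Type;
  pmap : forall A B : comAlgType k, {lrmorphism A -> B} -> points A -> points B;
  pmap_id : forall (A : comAlgType k) (x : points A),
    pmap (idfun : {lrmorphism A -> A}) x = x;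
  pmap_comp : forall (A B C : comAlgType k) (f : {lrmorphism A -> B})
    (g : {lrmorphism B -> C}) (x : points A),
    pmap (g \o f : {lrmorphism A -> C}) x = pmap g (pmap f x) }.

Record morphism (k : fieldType) (X Y : functor k) := Morphism {
  mor_fun :> forall A : comAlgType k, X A -> Y A;
  mor_nat : forall (A B : comAlgType k) (f : {lrmorphism A -> B}) (x : X A),
    mor_fun (pmap f x) = pmap f (mor_fun x) }.

Lemma lrmorphism_ext (k : fieldType) (A B : comAlgType k)
  (f g : {lrmorphism A -> B}) : f =1 g -> f = g.
Proof.
case: f g => [f [[f1] [f2] [f3]]] [g [[g1] [g2] [g3]]] /= /funext fg.
by subst g; rewrite (Prop_irrelevance f1 g1) (Prop_irrelevance f2 g2)
                    (Prop_irrelevance f3 g3).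
Qed.

Program Definition Spec (k : fieldType) (A0 : comAlgType k) : functor k :=
  {| points := fun A => {lrmorphism A0 -> A};
     pmap := fun A B (f : {lrmorphism A -> B}) (x : {lrmorphism A0 -> A}) =>
               (f \o x : {lrmorphism A0 -> B}) |}.
Next Obligation. by move=> k A0 A x; apply: lrmorphism_ext. Qed.
Next Obligation. by move=> k A0 A B C f g x; apply: lrmorphism_ext. Qed.

Definition is_field_alg (k : fieldType) (A : comAlgType k) : Prop :=
  forall a : A, a != 0 -> exists b : A, a * b = 1.

Definition fg_algebra (k : fieldType) (A : comAlgType k) : Prop :=
  exists s : seq A, forall S : A -> Prop,
    S 1 -> (forall a, a \in s -> S a) ->
    (forall a b, S a -> S b -> S (a + b)) ->
    (forall a b, S a -> S b -> S (a * b)) ->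
    (forall (c : k) a, S a -> S (c *: a)) ->
    forall a, S a.

Definition generates_unit (A : comNzRingType) (S : A -> Prop) : Prop :=
  exists (n : nat) (c s : 'I_n -> A),
    (forall i, S (s i)) /\ \sum_(i < n) c i * s i = 1.

(* [l] exhibits [B] as the localization of [A] at the powers of [f]. *)
Definition is_localization (k : fieldType) (A B : comAlgType k) (f : A)
    (l : {lrmorphism A -> B}) : Prop :=
  [/\ exists b, l f * b = 1,
      forall b, exists n a, l f ^+ n * b = l a
    & forall a, l a = 0 -> exists n, f ^+ n * a = 0].

(* Compatibility of the [x i] is tested on all algebras receiving both [B i]
   and [B j] over [A], rather than on the localizations at [f i * f j], which
   may be zero. *)
Definition zariski_sheaf (k : fieldType) (X : functor k) : Prop :=
  forall (A : comAlgType k) (n : nat) (f : 'I_n -> A)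
    (B : 'I_n -> comAlgType k) (l : forall i, {lrmorphism A -> B i}),
    generates_unit (fun a => exists i, a = f i) ->
    (forall i, is_localization (f i) (l i)) ->
    forall x : forall i, X (B i),
      (forall i j (C : comAlgType k) (u : {lrmorphism B i -> C})
         (v : {lrmorphism B j -> C}),
         u \o l i =1 v \o l j -> pmap u (x i) = pmap v (x j)) ->
      exists! y : X A, forall i, pmap (l i) y = x i.

(* All the immersions used below go into locally noetherian schemes, so the ideals
   defining their pull-backs to an affine scheme Spec A are finitely generated;
   they are given by finite lists of generators. *)

Definition in_image (k : fieldType) (Z X : functor k) (i : morphism Z X)
    (A : comAlgType k) (x : X A) : Prop := exists z : Z A, i A z = x.

Definition monic (k : fieldType) (Z X : functor k) (i : morphism Z X) : Prop :=
  forall A : comAlgType k, injective (i A).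

Definition vanish (A B : comNzRingType) (f : A -> B) (I : seq A) : Prop :=
  forall a, a \in I -> f a = 0.

Definition generate (A B : comNzRingType) (f : A -> B) (J : seq A) : Prop :=
  generates_unit (fun b => exists2 a, a \in J & b = f a).

Definition closed_immersion (k : fieldType) (Z X : functor k)
    (i : morphism Z X) : Prop :=
  monic i /\ forall (A : comAlgType k) (x : X A), exists I : seq A,
    forall (B : comAlgType k) (f : {lrmorphism A -> B}),
      in_image i (pmap f x) <-> vanish f I.

Definition open_immersion (k : fieldType) (Z X : functor k)
    (i : morphism Z X) : Prop :=
  monic i /\ forall (A : comAlgType k) (x : X A), exists J : seq A,
    forall (B : comAlgType k) (f : {lrmorphism A -> B}),
      in_image i (pmap f x) <-> generate f J.

Definition immersion (k : fieldType) (Z X : functor k)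
    (i : morphism Z X) : Prop :=
  monic i /\ forall (A : comAlgType k) (x : X A), exists I J : seq A,
    forall (B : comAlgType k) (f : {lrmorphism A -> B}),
      in_image i (pmap f x) <-> vanish f I /\ generate f J.

(* Schemes in the sense of Demazure and Gabriel: that open subfunctors cover the
   functor is tested on field-valued points. *)
Record scheme_ft (k : fieldType) := SchemeFT {
  scheme_functor :> functor k;
  scheme_sheaf : zariski_sheaf scheme_functor;
  scheme_cover : exists (n : nat) (A0 : 'I_n -> comAlgType k)
      (u : forall i, morphism (Spec (A0 i)) scheme_functor),
    [/\ forall i, fg_algebra (A0 i), forall i, open_immersion (u i)
      & forall (K : comAlgType k) (x : scheme_functor K), is_field_alg K ->
          exists i, in_image (u i) x] }.

Definition isomorphic (k : fieldType) (X Y : functor k) : Prop :=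
  exists f : morphism X Y, forall A : comAlgType k, bijective (f A).

(* [j] is the open subscheme of [X] complementary to the closed subscheme [i]. *)
Definition complementary (k : fieldType) (Y U X : functor k)
    (i : morphism Y X) (j : morphism U X) : Prop :=
  open_immersion j /\ forall (A : comAlgType k) (x : X A),
    in_image j x <-> forall (B : comAlgType k) (f : {lrmorphism A -> B}),
                       ~ in_image i (pmap f x).

Definition is_product (k : fieldType) (Z X Y : functor k) : Prop :=
  exists (p : morphism Z X) (q : morphism Z Y),
    forall A : comAlgType k, bijective (fun z : Z A => (p A z, q A z)).

(* K_0(Sch_k) is the quotient of [K0_term k] by [K0_eq]. It is kept as a setoid:
   being generated by functors on all MathComp algebras, it lives in a universe
   above that of the carriers of MathComp rings. *)
Inductive K0_term (k : fieldType) :=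
  | K0_class of scheme_ft k
  | K0_zero
  | K0_one
  | K0_opp of K0_term k
  | K0_add of K0_term k & K0_term k
  | K0_mul of K0_term k & K0_term k.

Arguments K0_zero {k}.
Arguments K0_one {k}.

Declare Scope K0_scope.
Delimit Scope K0_scope with K0.
Bind Scope K0_scope with K0_term.
Notation "0" := K0_zero : K0_scope.
Notation "1" := K0_one : K0_scope.
Notation "- a" := (K0_opp a) : K0_scope.
Notation "a + b" := (K0_add a b) : K0_scope.
Notation "a - b" := (K0_add a (K0_opp b)) : K0_scope.
Notation "a * b" := (K0_mul a b) : K0_scope.

Reserved Notation "a =K0 b" (at level 70, no associativity).

Inductive K0_eq (k : fieldType) : K0_term k -> K0_term k -> Prop :=
  | K0_refl a : a =K0 a
  | K0_sym a b : a =K0 b -> b =K0 a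
  | K0_trans a b c : a =K0 b -> b =K0 c -> a =K0 c
  | K0_cong_opp a a' : a =K0 a' -> (- a) =K0 (- a')
  | K0_cong_add a a' b b' : a =K0 a' -> b =K0 b' -> (a + b) =K0 (a' + b')
  | K0_cong_mul a a' b b' : a =K0 a' -> b =K0 b' -> (a * b) =K0 (a' * b')
  | K0_addA a b c : (a + (b + c)) =K0 (a + b + c)
  | K0_addC a b : (a + b) =K0 (b + a)
  | K0_add0 a : (0 + a) =K0 a
  | K0_addN a : (- a + a) =K0 0
  | K0_mulA a b c : (a * (b * c)) =K0 (a * b * c)
  | K0_mulC a b : (a * b) =K0 (b * a)
  | K0_mul1 a : (1 * a) =K0 a
  | K0_mulD a b c : ((a + b) * c) =K0 (a * c + b * c)
  | K0_iso (X Y : scheme_ft k) : isomorphic X Y -> K0_class X =K0 K0_class Y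
  | K0_scissor (X Y U : scheme_ft k) (i : morphism Y X) (j : morphism U X) :
      closed_immersion i -> complementary i j ->
      K0_class X =K0 (K0_class Y + K0_class U)
  | K0_prod (Z X Y : scheme_ft k) : is_product Z X Y ->
      K0_class Z =K0 (K0_class X * K0_class Y)
  | K0_point (X : scheme_ft k) : isomorphic X (Spec (k^o : comAlgType k)) ->
      K0_class X =K0 1
where "a =K0 b" := (K0_eq a%K0 b%K0).

(* A set of points of [X], given by the field-valued points it contains; the
   values at algebras that are not fields are irrelevant. *)
Definition point_set (k : fieldType) (X : functor k) :=
  forall K : comAlgType k, X K -> Prop.

(* [a] is the sum of the classes of the members of some finite partition of [C]
   into locally closed subschemes of finite type. *)
Definition has_class (k : fieldType) (X : functor k) (C : point_set X)
    (a : K0_term k) : Prop :=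
  exists (n : nat) (Z : 'I_n -> scheme_ft k) (i : forall j, morphism (Z j) X),
    [/\ forall j, immersion (i j),
        forall (K : comAlgType k) (x : X K), is_field_alg K ->
          C K x <-> exists j, in_image (i j) x,
        forall (K : comAlgType k) (x : X K) j1 j2, is_field_alg K ->
          in_image (i j1) x -> in_image (i j2) x -> j1 = j2
      & a =K0 \big[@K0_add k/K0_zero]_(j < n) K0_class (Z j)].

(* For a constructible [C] the element exists and is unique in K_0(Sch_k);
   [epsilon] picks a representing term. *)
Definition constructible_class (k : fieldType) (X : functor k)
    (C : point_set X) : K0_term k :=
  epsilon (inhabits K0_zero) (has_class C).

Definition submodule (A : comNzRingType) (W : finType)
    (L : {ffun W -> A} -> Prop) : Prop :=
  [/\ L 0, forall u v, L u -> L v -> L (u + v)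
    & forall a u, L u -> L [ffun w => a * u w]].

Definition span (A : comNzRingType) (W : finType)
    (S : {ffun W -> A} -> Prop) : {ffun W -> A} -> Prop :=
  fun u => forall L, submodule L -> (forall v, S v -> L v) -> L u.

(* The A-points of the projective space with homogeneous coordinates X_w, w in W,
   are the rank 1 local direct summands of A^W. Equivalently, they are the
   submodules on which all the 2 x 2 minors vanish and whose coordinates
   generate the unit ideal: where u w is invertible for some u in L, the
   vanishing of the minors says that u generates L. *)
Definition proj_point (A : comNzRingType) (W : finType)
    (L : {ffun W -> A} -> Prop) : Prop :=
  [/\ submodule L,
      forall u v, L u -> L v -> forall w w', u w * v w' = u w' * v w
    & generates_unit (fun a => exists u w, L u /\ a = u w)].

Definition map_vec (A B : comNzRingType) (W : finType) (f : A -> B)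
    (u : {ffun W -> A}) : {ffun W -> B} := [ffun w => f (u w)].

Definition extend_scalars (A B : comNzRingType) (W : finType) (f : A -> B)
    (L : {ffun W -> A} -> Prop) : {ffun W -> B} -> Prop :=
  span (fun v => exists2 u, L u & v = map_vec f u).

Lemma span_submodule (A : comNzRingType) (W : finType)
    (S : {ffun W -> A} -> Prop) : submodule (span S).
Proof.
split=> [L [L0 _ _] _ //|u v uS vS L mL SL|a u uS L mL SL].
  by case: (mL) => _ LD _; apply: LD; [apply: uS | apply: vS].
by case: (mL) => _ _ LZ; apply: LZ; apply: uS.
Qed.

Lemma sub_span (A : comNzRingType) (W : finType) (S : {ffun W -> A} -> Prop)
  u : S u -> span S u.
Proof. by move=> Su L _; apply. Qed.

Lemma extend_proj_point (k : fieldType) (A B : comAlgType k) (W : finType)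
    (f : {lrmorphism A -> B}) (L : {ffun W -> A} -> Prop) :
  proj_point L -> proj_point (extend_scalars f L).
Proof.
case=> mL minorL [n [c [s [sL cs]]]].
have minors u v : extend_scalars f L u -> extend_scalars f L v ->
    forall w w', u w * v w' = u w' * v w.
  have sub (u0 : {ffun W -> B}) : submodule (fun v : {ffun W -> B} => forall w w',
      u0 w * v w' = u0 w' * v w).
    split=> [w w'|v1 v2 h1 h2 w w'|a v1 h1 w w']; rewrite !ffunE.
    - by rewrite !mulr0.
    - by rewrite !mulrDr h1 h2.
    - by rewrite mulrCA h1 mulrCA.
  move=> uL vL; refine (vL _ (sub u) _) => _ [v' Lv ->] w w'.
  rewrite mulrC [RHS]mulrC.
  refine (uL _ (sub (map_vec f v')) _ w' w) => _ [u' Lu ->] w1 w2.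
  by rewrite !ffunE -!rmorphM /= (minorL _ _ Lv Lu).
split=> //; first exact: span_submodule.
exists n, (f \o c), (f \o s); split=> [i|]; last first.
  by rewrite -(rmorph1 f) -cs rmorph_sum; apply: eq_bigr => i _; rewrite rmorphM.
have [u [w [Lu su]]] := sL i; rewrite /= su; exists (map_vec f u), w; split; last by rewrite ffunE.
by apply: sub_span; exists u.
Qed.

Program Definition proj_space (k : fieldType) (W : finType) : functor k :=
  {| points := fun A => {L : {ffun W -> A} -> Prop | proj_point L};
     pmap := fun A B (f : {lrmorphism A -> B}) L =>
               exist _ (extend_scalars f (proj1_sig L)) _ |}.
Next Obligation. by move=> k W A B f [L pL]; apply: extend_proj_point. Qed.
Next Obligation.
move=> k W A [L pL] /=; apply: eq_exist; apply/funext=> u; apply/propext.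
split=> [uL|Lu]; last by apply: sub_span; exists u => //; apply/ffunP=> w; rewrite ffunE.
case: (pL) => mL _ _; apply: (uL _ mL) => _ [v Lv ->].
by rewrite (_ : map_vec _ _ = v) //; apply/ffunP=> w; rewrite ffunE.
Qed.
Next Obligation.
move=> k W A B C f g [L pL] /=; apply: eq_exist; apply/funext=> u; apply/propext.
split=> uL; apply: (uL _ (span_submodule _)) => {u uL} _ [u Lu ->].
  apply: sub_span; exists (map_vec f u); first by apply: sub_span; exists u.
  by apply/ffunP=> w; rewrite !ffunE.
pose M (v : {ffun W -> B}) := extend_scalars (g \o f) L (map_vec g v).
apply: (Lu M) => [|_ [v Lv ->]]; last first.
  by apply: sub_span; exists v => //; apply/ffunP=> w; rewrite !ffunE.
case: (span_submodule (fun v => exists2 u, L u & v = map_vec (g \o f) u)).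
move=> S0 SD SZ; split=> [|v1 v2 h1 h2|a v h]; rewrite /M.
- rewrite (_ : map_vec _ _ = 0) //.
  by apply/ffunP=> w; rewrite !ffunE rmorph0.
- rewrite (_ : map_vec _ _ = map_vec g v1 + map_vec g v2); first exact: SD.
  by apply/ffunP=> w; rewrite !ffunE rmorphD.
- rewrite (_ : map_vec _ _ = [ffun w => g a * map_vec g v w]); first exact: SZ.
  by apply/ffunP=> w; rewrite !ffunE rmorphM.
Qed.

(* At a field [K], a point of the projective space is a line in K^W. *)
Definition coord_zero (k : fieldType) (W : finType) (K : comAlgType k)
    (L : proj_space k W K) (w : W) : Prop := forall u, proj1_sig L u -> u w = 0.

Definition coord_nonzero (k : fieldType) (W : finType) (K : comAlgType k)
    (L : proj_space k W K) (w : W) : Prop := ~ coord_zero L w.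

Definition ambient (k : fieldType) (G : loose_graph) : functor k :=
  proj_space k (vert (completion G)).

Definition affine_piece (k : fieldType) (G : loose_graph) (v : vert G) :
  point_set (ambient k G) := fun K L =>
  coord_nonzero L (old_vert v) /\
  forall w : vert (completion G), w != old_vert v -> ~~ adj (old_vert v) w ->
    coord_zero L w.

(* For an edge [e] without vertices: the vertices of the completion incident
   with [e] are its two added ends. *)
Definition multiplicative_piece (k : fieldType) (G : loose_graph) (e : edge G) :
  point_set (ambient k G) := fun K L =>
  forall w : vert (completion G),
    if inc w (e : edge (completion G)) then coord_nonzero L w
    else coord_zero L w.

(* F(G) (x) k. It is constructible in the ambient space, in general not locally
   closed. *)
Definition F_points (k : fieldType) (G : loose_graph) :
  point_set (ambient k G) := fun K L =>
  (exists v : vert G, @affine_piece k G v K L) \/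
  (exists2 e : edge G, ends e = set0 & @multiplicative_piece k G e K L).

(* The Grothendieck polynomial of [G], as an element of K_0(Sch_k). *)
Definition grothendieck (k : fieldType) (G : loose_graph) : K0_term k :=
  constructible_class (@F_points k G).

(* Main.v *)
From HB Require Import structures.
From mathcomp Require Import all_boot all_order all_algebra.
From Stdlib Require Import ClassicalEpsilon.
From mathcomp Require Import generic_quotient boolp.
From mathcomp Require classical_sets.
Require Import Defs.

(* The points of F(G) are determined by their support, the set S of their
   nonzero coordinates: S has to lie in the closed star of one of its vertices,
   or to consist of the two ends of an edge without vertices. The points of
   support S form a torus of dimension |S| - 1, so that the class of F(G) is the
   sum of the classes of these tori. (Any other partition of F(G) into locally
   closed subschemes is compared with this one by cutting its members along the
   coordinate hyperplanes, and then each affine torus along its members.)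

   A support centred at x or y lies in P_{x,y}, and resolving xy does not change
   the closed star of any other vertex. Hence the supports not contained in
   P_{x,y} are the same for G and for G_xy, and the supports contained in P_{x,y}
   are those of the induced loose graphs. *)

Set Implicit Arguments.
Unset Strict Implicit.
Unset Printing Implicit Defensive.

Import GRing.Theory.
Local Open Scope ring_scope.
Local Open Scope quotient_scope.

(** * Quotients of algebras *)

(** The class of a constructible set is chosen by [epsilon], so it is known only once all partitions
    are shown to give the same sum. The obstacle is that the scissor relation cuts along a closed
    subscheme and its open complement, whereas the members of a partition are merely locally closed.
    Two kinds of cut get around it: on any scheme, a stratum is a finite intersection of coordinate
    hyperplanes and complements of such; on an affine scheme, a locally closed condition evaluated
    at the universal point is one global pair V(I), D(J). Hence the tori are realised as spectra of
    Laurent algebras. The pieces of a refinement must again be schemes of finite type, which calls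
    for charts made from quotients and localizations. As all algebras are nonzero, empty pieces and
    nilpotent denominators are separate cases. The classes of the tori are never expanded in the
    class of the affine line: it is enough that they depend on |S| alone. *)

Lemma lrmorphism_of (k : fieldType) (A B : comAlgType k) (f : A -> B) :
    (forall a b, f (a + b) = f a + f b) -> f 1 = 1 ->
    (forall a b, f (a * b) = f a * f b) ->
    (forall c a, f (c *: a) = c *: f a) ->
  exists g : {lrmorphism A -> B}, forall a, g a = f a.
Proof.
move=> fD f1 fM fZ.
have fB : zmod_morphism f.
  by move=> a b; rewrite fD -scaleN1r fZ scaleN1r.
have fm : monoid_morphism f by split=> //; apply: fM.
pose h1 := GRing.isZmodMorphism.Build A B f fB.
pose h2 := GRing.isMonoidMorphism.Build A B f fm.
pose h3 := GRing.isScalable.Build k A B *:%R f fZ.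
pose g : {lrmorphism A -> B} := HB.pack f h1 h2 h3.
by exists g.
Qed.

Definition ideal (A : comNzRingType) (I : A -> Prop) : Prop :=
  [/\ I 0, forall a b, I a -> I b -> I (a + b) & forall a b, I b -> I (a * b)].

Section Quotient.
Variables (k : fieldType) (A : comAlgType k) (I : A -> Prop).
Hypotheses (idI : ideal I) (properI : ~ I 1).

Let I0 : I 0. Proof. by case: idI. Qed.
Let ID a b : I a -> I b -> I (a + b). Proof. by case: idI => _ + _; apply. Qed.
Let IM a b : I b -> I (a * b). Proof. by case: idI => _ _; apply. Qed.
Let IN a : I a -> I (- a). Proof. by rewrite -mulN1r; apply: IM. Qed.

Definition coset_eq (a b : A) : bool := `[< I (a - b) >].

Fact coset_eq_equiv : equiv_class_of coset_eq.
Proof.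
split=> [a|a b|b a c].
- by apply/asboolP; rewrite subrr.
- by apply/asboolP/asboolP => /IN; rewrite opprB.
move=> /asboolP ab /asboolP bc; apply/asboolP.
by have := ID ab bc; rewrite addrA subrK.
Qed.

Canonical coset_eq_equivRel := EquivRelPack coset_eq_equiv.

Definition quot := {eq_quot coset_eq}.
HB.instance Definition _ : EqQuotient A coset_eq quot := EqQuotient.on quot.
HB.instance Definition _ := Choice.on quot.

Let pi (a : A) : quot := \pi a.

Let pi_eqP a b : pi a = pi b <-> I (a - b).
Proof.
split=> [/eqP|h]; first by rewrite piE => /asboolP.
by apply/eqP; rewrite piE; apply/asboolP.
Qed.

Let quotP (x : quot) : exists a, x = pi a.
Proof. by exists (repr x); rewrite /pi reprK. Qed.

Let add (x y : quot) : quot := pi (repr x + repr y).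
Let opp (x : quot) : quot := pi (- repr x).
Let mul (x y : quot) : quot := pi (repr x * repr y).
Let scale (c : k) (x : quot) : quot := pi (c *: repr x).

Let repr_pi a : I (repr (pi a) - a).
Proof. by apply/pi_eqP; rewrite /pi reprK. Qed.

Let piD a b : add (pi a) (pi b) = pi (a + b).
Proof. by apply/pi_eqP; rewrite opprD addrACA; apply: ID. Qed.
Let piN a : opp (pi a) = pi (- a).
Proof. by apply/pi_eqP; rewrite -opprD; apply: IN. Qed.
Let piM a b : mul (pi a) (pi b) = pi (a * b).
Proof.
apply/pi_eqP; rewrite (_ : _ - _ = repr (pi a) * (repr (pi b) - b) +
  b * (repr (pi a) - a)); first by apply: ID; apply: IM.
by rewrite !mulrBr addrA (mulrC b) subrK (mulrC b).
Qed.
Let piZ c a : scale c (pi a) = pi (c *: a).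
Proof. by apply/pi_eqP; rewrite -scalerBr -mulr_algl; apply: IM. Qed.

Let addA : associative add.
Proof.
move=> x y z; have [[[a ->] [b ->]] [c ->]] := (quotP x, quotP y, quotP z).
by rewrite !piD addrA.
Qed.
Let addC : commutative add.
Proof. by move=> x y; rewrite /add addrC. Qed.
Let add0 : left_id (pi 0) add.
Proof. by move=> x; have [a ->] := quotP x; rewrite piD add0r. Qed.
Let addN : left_inverse (pi 0) opp add.
Proof. by move=> x; have [a ->] := quotP x; rewrite piN piD addNr. Qed.

HB.instance Definition _ := GRing.isZmodule.Build quot addA addC add0 addN.

Let mulA : associative mul.
Proof.
move=> x y z; have [[[a ->] [b ->]] [c ->]] := (quotP x, quotP y, quotP z).
by rewrite !piM mulrA.
Qed.
Let mulC : commutative mul.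
Proof. by move=> x y; rewrite /mul mulrC. Qed.
Let mul1 : left_id (pi 1) mul.
Proof. by move=> x; have [a ->] := quotP x; rewrite piM mul1r. Qed.
Let mulDl : left_distributive mul add.
Proof.
move=> x y z; have [[[a ->] [b ->]] [c ->]] := (quotP x, quotP y, quotP z).
by rewrite !(piD, piM) mulrDl.
Qed.
Let one_neq0 : pi 1 != (0 : quot).
Proof. by apply/eqP => h; apply: properI; have /pi_eqP := h; rewrite subr0. Qed.

HB.instance Definition _ :=
  GRing.Zmodule_isComNzRing.Build quot mulA mulC mul1 mulDl one_neq0.

Let scaleA (c d : k) (x : quot) : scale c (scale d x) = scale (c * d) x.
Proof. by have [a ->] := quotP x; rewrite !piZ scalerA. Qed.
Let scale1 : left_id 1 scale.
Proof. by move=> x; have [a ->] := quotP x; rewrite piZ scale1r. Qed.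
Let scaleDr : right_distributive scale add.
Proof.
move=> c x y; have [[a ->] [b ->]] := (quotP x, quotP y).
by rewrite !(piZ, piD) scalerDr.
Qed.
Let scaleDl (x : quot) : {morph scale^~ x : c d / c + d >-> add c d}.
Proof.
by move=> c d; have [a ->] := quotP x; rewrite !(piZ, piD) scalerDl.
Qed.

HB.instance Definition _ :=
  GRing.Zmodule_isLmodule.Build k quot scaleA scale1 scaleDr scaleDl.

Let scaleAl (c : k) (x y : quot) : c *: (x * y) = c *: x * y.
Proof.
have [[a ->] [b ->]] := (quotP x, quotP y).
by rewrite -[LHS]/(scale c (mul _ _)) -[RHS]/(mul (scale c _) _) !(piZ, piM) scalerAl.
Qed.

HB.instance Definition _ := GRing.Lmodule_isLalgebra.Build k quot scaleAl.
HB.instance Definition _ := GRing.Lalgebra_isComAlgebra.Build k quot.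

(** Surjectivity and the kernel are all that is used of the quotient later on. Properness of the
    ideal makes the quotient nonzero, as [comAlgType] demands. *)
Lemma quotient_exists : exists (Q : comAlgType k) (p : {lrmorphism A -> Q}),
  (forall x, exists a, x = p a) /\ (forall a, p a = 0 <-> I a).
Proof.
have [//|//|//|//|p pE] := @lrmorphism_of k A (quot : comAlgType k) pi.
exists (quot : comAlgType k), p; split=> [x|a].
  by have [a ->] := quotP x; exists a; rewrite pE.
by rewrite pE; have := pi_eqP a 0; rewrite subr0.
Qed.

End Quotient.

(** * Residue fields and localizations *)

Lemma residue_field (k : fieldType) (A : comAlgType k) :
  exists (K : comAlgType k), is_field_alg K /\ inhabited {lrmorphism A -> K}.
Proof.
(* Membership of 0 is left out, so that the union of the empty chain still satisfies [P]; it is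
   recovered for the maximal element as [M0]. *)
pose P (J : A -> Prop) := [/\ forall a b, J a -> J b -> J (a + b),
  forall a b, J b -> J (a * b) & ~ J 1].
have [F FP totF|M [[MD MM M1] maxM]] := @classical_sets.Zorn_bigcup A P.
  split=> [a b [J FJ Ja] [J' FJ' J'b]|a b [J FJ Jb]|[J FJ J1]].
  - have [JJ'|J'J] := totF _ _ FJ FJ'.
      by exists J' => //; have [+ _ _] := FP _ FJ'; apply => //; apply: JJ'.
    by exists J => //; have [+ _ _] := FP _ FJ; apply => //; apply: J'J.
  - by exists J => //; have [_ + _] := FP _ FJ; apply.
  - by have [_ _] := FP _ FJ; apply.
have inM (J : A -> Prop) : P J -> (forall a, M a -> J a) -> forall a, J a -> M a.
  move=> PJ MJ a Ja; apply: contrapT => nMa; apply: (maxM J) => //.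
  by split=> //; apply: contra_not nMa => /(_ a); apply.
have M0 : M 0.
  apply: (inM (fun a => M a \/ a = 0)); [|by left|by right].
  split=> [a b [Ma|->] [Mb|->]|a b [Mb|->]|[//|/eqP]].
  - by left; apply: MD.
  - by rewrite addr0; left.
  - by rewrite add0r; left.
  - by rewrite addr0; right.
  - by left; apply: MM.
  - by rewrite mulr0; right.
  - by rewrite oner_eq0.
have [//|K [p [p_surj p0]]] := quotient_exists (And3 M0 MD MM).
exists K; split; last by exists; exact: p.
move=> x; have [a ->] := p_surj x => pa0.
(* This is the ideal M + (a): either it contains 1, which yields an inverse of [a] modulo M, or it
   is proper and maximality puts [a] in M. *)
pose J b := exists m r, M m /\ b = m + r * a.
have [[m [r [Mm E]]]|nJ1] := pselect (J 1).
  exists (p r); have := congr1 p E.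
  by rewrite rmorph1 rmorphD rmorphM /= (p0 m).2 // add0r mulrC => ->.
suff Ma : M a by rewrite (p0 a).2 ?eqxx in pa0.
apply: (inM J) => [|m Mm|]; last by exists 0, 1; rewrite add0r mul1r.
  split=> // [b c [m [r [Mm ->]]] [n [s [Mn ->]]]|b c [m [r [Mm ->]]]].
    by exists (m + n), (r + s); rewrite mulrDl addrACA; split=> //; apply: MD.
  by exists (b * m), (b * r); rewrite mulrDr mulrA; split=> //; apply: MM.
by exists m, 0; rewrite mul0r addr0.
Qed.

Lemma field_algP (k : fieldType) (K : comAlgType k) (a b : K) :
  is_field_alg K -> a * b = 0 -> a = 0 \/ b = 0.
Proof.
move=> fK ab0; have [->|a0] := eqVneq a 0; [by left | right].
by have [c ac] := fK a a0; rewrite -(mul1r b) -ac mulrAC ab0 mul0r.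
Qed.

Lemma field_alg_expf_neq0 (k : fieldType) (K : comAlgType k) (a : K) n :
  is_field_alg K -> a <> 0 -> a ^+ n <> 0.
Proof.
move=> fK a0; elim: n => [|n IHn]; first by apply/eqP; rewrite expr0 oner_eq0.
by rewrite exprS => /(field_algP fK)[].
Qed.

Section UnitIdeal.
Variables (k : fieldType) (A : comAlgType k).
Implicit Types S : A -> Prop.

(** The ideal generated by [S]; [generates_unit S] unfolds to [combination S 1]. *)
Definition combination S (a : A) : Prop :=
  exists (n : nat) (c s : 'I_n -> A), (forall i, S (s i)) /\ \sum_(i < n) c i * s i = a.

Lemma combination_ideal S : ideal (combination S).
Proof.
split=> [|a b [n [c [s [Ss <-]]]] [m [d [t [St <-]]]]|a b [n [c [s [Ss <-]]]]].
- by exists 0, (fun=> 0), (fun=> 0); split=> [[]//|]; rewrite big_ord0.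
- pose glue (f : 'I_n -> A) (g : 'I_m -> A) i :=
    match split i with inl j => f j | inr j => g j end.
  exists (n + m), (glue c d), (glue s t); split=> [i|].
    by rewrite /glue; case: (fintype.split i).
  rewrite big_split_ord /=; congr (_ + _); apply: eq_bigr => i _.
    by rewrite /glue (unsplitK (inl i)).
  by rewrite /glue (unsplitK (inr i)).
- exists n, (fun i => a * c i), s; split=> //; rewrite mulr_sumr.
  by apply: eq_bigr => i _; rewrite mulrA.
Qed.

Lemma combination_gen S a : S a -> combination S a.
Proof.
move=> Sa; exists 1, (fun=> 1), (fun=> a); split=> //.
by rewrite big_ord1 mul1r.
Qed.

Lemma ideal_combination (I : A -> Prop) S a :
  ideal I -> (forall s, S s -> I s) -> combination S a -> I a.
Proof.
case=> I0 ID IM SI [n [c [s [Ss <-]]]].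
by apply: big_ind => // i _; apply: IM; apply: SI.
Qed.

(** If the generated ideal misses 1, its quotient is nonzero and has a residue field, at which all
    of [S] vanishes. Open conditions can therefore be tested on field-valued points. *)
Lemma generates_unitP S : generates_unit S <->
  forall (K : comAlgType k) (f : {lrmorphism A -> K}), is_field_alg K ->
    exists2 s, S s & f s <> 0.
Proof.
split=> [[n [c [s [Ss cs1]]]] K f fK|hS].
  apply: contrapT => nS; have /eqP := oner_neq0 K; apply.
  rewrite -(rmorph1 f) -cs1 rmorph_sum big1 // => i _.
  rewrite rmorphM /=; suff -> : f (s i) = 0 by rewrite mulr0.
  by apply: contrapT => si0; apply: nS; exists (s i).
apply: contrapT => S1.
have [Q [p [_ p0]]] := quotient_exists (combination_ideal S) S1.
have [K [fK [g]]] := residue_field Q.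
have [s Ss] := hS K (g \o p : {lrmorphism A -> K}) fK; apply.
by rewrite /= (p0 s).2 ?rmorph0 //; apply: combination_gen.
Qed.

End UnitIdeal.

Lemma generateP (k : fieldType) (A B : comAlgType k) (f : {lrmorphism A -> B})
    (J : seq A) : generate f J <->
  forall (K : comAlgType k) (g : {lrmorphism B -> K}), is_field_alg K ->
    exists2 a, a \in J & g (f a) <> 0.
Proof.
split=> [/generates_unitP hJ K g fK|hJ].
  by have [b [a aJ ->] ga] := hJ K g fK; exists a.
apply/generates_unitP => K g fK; have [a aJ ga] := hJ K g fK.
by exists (f a) => //; exists a.
Qed.

Section Localization.
Variables (k : fieldType) (A L : comAlgType k) (f : A) (l : {lrmorphism A -> L}).
Hypothesis locL : is_localization f l.

Lemma localization_lift (B : comAlgType k) (g : {lrmorphism A -> B}) :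
  (exists b, g f * b = 1) ->
  exists h : {lrmorphism L -> B}, forall a, h (l a) = g a.
Proof.
case: locL => [[b0 fb0] frac ker] [c gc].
have gfK n y z : g f ^+ n * y = g f ^+ n * z -> y = z.
  move=> /(congr1 ( *%R (c ^+ n))); rewrite !mulrA -exprMn (mulrC c) gc.
  by rewrite expr1n !mul1r.
have eqg a a' : l a = l a' -> g a = g a'.
  move=> E; have [|n /(congr1 g)] := ker (a - a').
    by rewrite rmorphB /= E subrr.
  rewrite rmorphM rmorphXn rmorphB rmorph0 /= => gn; apply/eqP.
  by rewrite -subr_eq0; apply/eqP/(gfK n); rewrite gn mulr0.
(* [y] is the fraction g(a) / g(f)^n attached to an expression of [b] as l(a) / l(f)^n. The lift is
   obtained as a functional relation, because the localization is known only by its properties. *)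
pose R b y := exists n a, l f ^+ n * b = l a /\ g f ^+ n * y = g a.
have Rfun b y z : R b y -> R b z -> y = z.
  move=> [n [a [la ga]]] [m [a' [la' ga']]]; apply: (gfK (n + m)%N).
  rewrite exprD mulrAC ga -mulrA ga' mulrC -!rmorphXn -!rmorphM; apply: eqg.
  by rewrite !rmorphM !rmorphXn /= -la -la' mulrCA.
have Rtot b : exists y, R b y.
  have [n [a la]] := frac b; exists (c ^+ n * g a), n, a; split=> //.
  by rewrite mulrA -exprMn gc expr1n mul1r.
have [h hP] := choice Rtot.
have hE b y : R b y -> h b = y by apply: Rfun.
have Rl a : R (l a) (g a) by exists 0, a; rewrite !expr0 !mul1r.
have [||||h' h'E] := @lrmorphism_of k L B h.
- move=> a b; apply: hE.
  have [n [a' [la ga]]] := hP a; have [m [b' [lb gb]]] := hP b.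
  exists (n + m)%N, (f ^+ m * a' + f ^+ n * b').
  rewrite !rmorphD !rmorphM !rmorphXn /= -la -lb -ga -gb !mulrDr !exprD.
  by split; congr (_ + _); rewrite mulrA // (mulrC (_ ^+ m)).
- by apply: hE; have := Rl 1; rewrite !rmorph1.
- move=> a b; apply: hE.
  have [n [a' [la ga]]] := hP a; have [m [b' [lb gb]]] := hP b.
  exists (n + m)%N, (a' * b'); rewrite !rmorphM /= -la -lb -ga -gb !exprD.
  by split; rewrite mulrACA.
- move=> d a; apply: hE; have [n [a' [la ga]]] := hP a.
  by exists n, (d *: a'); rewrite !linearZ /= -la -ga -!scalerAr.
by exists h' => a; rewrite h'E; apply: hE.
Qed.

Lemma localization_epi (B : comAlgType k) (g h : {lrmorphism L -> B}) :
  (forall a, g (l a) = h (l a)) -> forall b, g b = h b.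
Proof.
case: locL => [[b0 fb0] frac _] gh b; have [n [a E]] := frac b.
have {}E : b = b0 ^+ n * l a.
  by rewrite -E mulrA -exprMn (mulrC b0) fb0 expr1n mul1r.
have gb0 : g b0 = h b0.
  rewrite -(mulr1 (g b0)) -(rmorph1 h) -fb0 rmorphM /= mulrA -gh.
  by rewrite -rmorphM (mulrC b0) fb0 rmorph1 mul1r.
by rewrite E !rmorphM !rmorphXn /= gb0 gh.
Qed.

End Localization.

(** * Polynomial algebras and affine pieces *)

(* MathComp makes [{poly A}] an algebra over [A] only. *)
Definition poly_over (k : fieldType) (A : comAlgType k) : Type := {poly A}.

Section PolyOver.
Variables (k : fieldType) (A : comAlgType k).

HB.instance Definition _ := GRing.ComNzRing.copy (poly_over A) {poly A}.

Let scale (c : k) (p : poly_over A) : poly_over A := (c%:A : A) *: (p : {poly A}).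

Let scaleA (c d : k) p : scale c (scale d p) = scale (c * d) p.
Proof. by rewrite /scale scalerA -scalerAl mul1r scalerA. Qed.
Let scale1 : left_id 1 scale.
Proof. by move=> p; rewrite /scale !scale1r. Qed.
Let scaleDr : right_distributive scale +%R.
Proof. by move=> c p q; apply: (@scalerDr A {poly A}). Qed.
Let scaleDl p : {morph scale^~ p : c d / c + d}.
Proof. by move=> c d; rewrite /scale scalerDl (@scalerDl A {poly A}). Qed.

HB.instance Definition _ :=
  GRing.Zmodule_isLmodule.Build k (poly_over A) scaleA scale1 scaleDr scaleDl.

Let scaleAl (c : k) (p q : poly_over A) : c *: (p * q) = c *: p * q.
Proof. exact: (@scalerAl A {poly A}). Qed.

HB.instance Definition _ := GRing.Lmodule_isLalgebra.Build k (poly_over A) scaleAl.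
HB.instance Definition _ := GRing.Lalgebra_isComAlgebra.Build k (poly_over A).

Definition poly_alg : comAlgType k := poly_over A.

Lemma poly_const : exists c : {lrmorphism A -> poly_alg}, forall a, c a = a%:P.
Proof.
apply: lrmorphism_of => [a b||a b|c a].
- exact: polyCD.
- by [].
- exact: polyCM.
- by rewrite -[RHS]/((c%:A : A) *: a%:P) -mul_polyC -polyCM mulr_algl.
Qed.

Lemma poly_lift (B : comAlgType k) (g : {lrmorphism A -> B}) (b : B) :
  exists h : {lrmorphism poly_alg -> B},
    (forall a, h (a%:P : {poly A}) = g a) /\ h ('X : {poly A}) = b.
Proof.
pose e (p : poly_alg) := horner_morph (fun a => mulrC b (g a)) (p : {poly A}).
have [||||h hE] := @lrmorphism_of k poly_alg B e.
- exact: rmorphD.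
- exact: rmorph1.
- exact: rmorphM.
- move=> c p; rewrite -[c *: p]/((c%:A : A) *: (p : {poly A})) /e -mul_polyC rmorphM /=.
  by rewrite horner_morphC -[X in X * _]/(g c%:A) linearZ /= rmorph1 mulr_algl.
by exists h; split=> [a|]; rewrite hE /e ?horner_morphC ?horner_morphX.
Qed.

Lemma poly_epi (B : comAlgType k) (g h : {lrmorphism poly_alg -> B}) :
    (forall a, g (a%:P : {poly A}) = h (a%:P : {poly A})) ->
    g ('X : {poly A}) = h ('X : {poly A}) ->
  forall p, g p = h p.
Proof.
move=> ghC ghX; apply: (@poly_ind A) => [|p a IHp].
  by rewrite (rmorph0 g) (rmorph0 h).
by rewrite (rmorphD g) (rmorphD h) (rmorphM g) (rmorphM h) /= IHp ghC ghX.
Qed.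

End PolyOver.

Section Constructions.
Variable k : fieldType.
Implicit Types A B : comAlgType k.

(** The localization is A[X] / (f X - 1). Non-nilpotency of [f] is exactly what keeps it nonzero. *)
Lemma localization_exists A (f : A) : (forall n, f ^+ n <> 0) ->
  exists (L : comAlgType k) (l : {lrmorphism A -> L}), is_localization f l.
Proof.
move=> fn0; pose d : {poly A} := f *: 'X - 1.
pose I (p : poly_alg A) := exists q : {poly A}, p = q * d :> {poly A}.
have idI : ideal I.
  split=> [|p q [p' ->] [q' ->]|p q [q' ->]].
  - by exists 0; rewrite mul0r.
  - by exists (p' + q'); rewrite mulrDl.
  - by exists (p * q'); rewrite mulrA.
have ker (a : A) : I (a%:P : {poly A}) -> exists n, f ^+ n * a = 0.
  case=> q E; exists (size q).
  (* Comparing coefficients in a = q (f X - 1) determines q recursively; its coefficients vanish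
     from degree [size q] on, which bounds the power of [f] killing [a]. *)
  have qi i : q`_i = - (f ^+ i * a).
    elim: i => [|i IHi].
      have := congr1 (fun p : {poly A} => p`_0) E.
      rewrite coefC eqxx mulrBr mulr1 coefB -scalerAr coefZ coefMX eqxx mulr0.
      by rewrite sub0r expr0 mul1r => ->; rewrite opprK.
    have := congr1 (fun p : {poly A} => p`_i.+1) E.
    rewrite coefC /= mulrBr mulr1 coefB -scalerAr coefZ coefMX /= IHi.
    by move/esym/eqP; rewrite subr_eq0 => /eqP <-; rewrite mulrN exprS mulrA.
  by apply: oppr_inj; rewrite -qi oppr0 nth_default.
have I1 : ~ I 1.
  by case/(ker 1) => n; rewrite mulr1; apply: fn0.
have [L [p [p_surj p0]]] := quotient_exists idI I1.
have [c cE] := poly_const A.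
have lE a : p (c a) = p (a%:P : {poly A}) by rewrite cE.
have lfX : p (c f) * p ('X : {poly A}) = 1.
  rewrite lE -rmorphM /= -(rmorph1 p); apply/eqP; rewrite -subr_eq0 -rmorphB.
  by apply/eqP/p0; exists 1; rewrite mul1r /d -mul_polyC.
exists L, (p \o c : {lrmorphism A -> L}); split=> /= [|b|a].
- by exists (p ('X : {poly A})).
- have [q ->] := p_surj b; elim/(@poly_ind A): q => [|q a [n [a' E]]].
    by exists 0%N, 0; rewrite !rmorph0 mulr0.
  exists n.+1, (a' + f ^+ n.+1 * a).
  rewrite (rmorphD p) (rmorphM p) /= -lE mulrDr exprSr -mulrA.
  rewrite (mulrCA (p (c f))) lfX mulr1 E.
  by rewrite !rmorphD !rmorphM !rmorphXn /= exprSr.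
- by rewrite lE => /p0/ker.
Qed.

Lemma fg_extension A B (g : {lrmorphism A -> B}) (t : seq B) :
    fg_algebra A ->
    (forall S : B -> Prop, (forall a, S (g a)) -> (forall b, b \in t -> S b) ->
      (forall a b, S a -> S b -> S (a + b)) ->
      (forall a b, S a -> S b -> S (a * b)) -> forall b, S b) ->
  fg_algebra B.
Proof.
case=> s fgs genB; exists (map g s ++ t) => S S1 Sst SD SM SZ.
apply: genB => // [a|b bt]; last by apply: Sst; rewrite mem_cat bt orbT.
apply: (fgs (fun a => S (g a))) => [|b bs|b c Sb Sc|b c Sb Sc|c b Sb].
- by rewrite rmorph1.
- by apply: Sst; rewrite mem_cat map_f.
- by rewrite rmorphD; apply: SD.
- by rewrite rmorphM; apply: SM.
- by rewrite linearZ; apply: SZ.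
Qed.

Lemma fg_base : fg_algebra (k^o : comAlgType k).
Proof.
exists [::] => S S1 _ _ _ SZ a.
by have := SZ a 1 S1; rewrite -[a *: _]/(a * 1) mulr1.
Qed.

Lemma fg_poly A : fg_algebra A -> fg_algebra (poly_alg A).
Proof.
move=> fgA; have [c cE] := poly_const A.
apply: (@fg_extension _ _ c [:: ('X : {poly A}) : poly_alg A]) => //.
move=> S Sc SX SD SM; apply: (@poly_ind A) => [|p a Sp].
  by have := Sc 0; rewrite rmorph0.
apply: SD; last by have := Sc a; rewrite cE.
by apply: SM => //; apply: SX; rewrite inE.
Qed.

Lemma fg_localization A B (f : A) (l : {lrmorphism A -> B}) :
  is_localization f l -> fg_algebra A -> fg_algebra B.
Proof.
move=> [[b0 fb0] frac _] fgA; apply: (@fg_extension _ _ l [:: b0]) => //.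
move=> S Sl Sb SD SM b; have [n [a E]] := frac b.
have -> : b = b0 ^+ n * l a.
  by rewrite -E mulrA -exprMn (mulrC b0) fb0 expr1n mul1r.
apply: (SM) => //; elim: n {E} => [|n IHn].
  by rewrite expr0; have := Sl 1; rewrite rmorph1.
by rewrite exprS; apply: SM => //; apply: Sb; rewrite inE.
Qed.

(* [q] is the inclusion of the affine subscheme V(I) /\ D(f) of Spec A. *)
Lemma affine_piece_exists A (I : seq A) (f : A) B0 (g0 : {lrmorphism A -> B0}) :
    vanish g0 I -> (exists b, g0 f * b = 1) -> fg_algebra A ->
  exists (C : comAlgType k) (q : {lrmorphism A -> C}),
    [/\ fg_algebra C,
        vanish q I /\ (exists b, q f * b = 1),
        forall B (g : {lrmorphism A -> B}), vanish g I ->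
          (exists b, g f * b = 1) ->
          exists h : {lrmorphism C -> B}, forall a, h (q a) = g a
      & forall B (g h : {lrmorphism C -> B}),
          (forall a, g (q a) = h (q a)) -> forall c, g c = h c].
Proof.
move=> g0I [b0 g0f] fgA; pose J := combination (fun a => a \in I).
have kill B (g : {lrmorphism A -> B}) a : vanish g I -> J a -> g a = 0.
  move=> gI; apply: (@ideal_combination _ _ (fun a => g a = 0)) => //; split=> [|b c gb gc|b c gc].
  - exact: rmorph0.
  - by rewrite rmorphD /= gb gc addr0.
  - by rewrite rmorphM /= gc mulr0.
(* The point [g0] witnesses that the piece is nonempty: it makes the ideal proper here, and the
   image of [f] in the quotient non-nilpotent below. *)
have J1 : ~ J 1.
  by move/(kill _ g0 _ g0I)/eqP; rewrite rmorph1 oner_eq0.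
have [Q [p [p_surj p0]]] := quotient_exists (combination_ideal _) J1.
have lift B (g : {lrmorphism A -> B}) : vanish g I ->
    exists h : {lrmorphism Q -> B}, forall a, h (p a) = g a.
  move=> gI; have [s sK] := choice p_surj.
  have sE a : g (s (p a)) = g a.
    apply/eqP; rewrite -subr_eq0 -rmorphB; apply/eqP/(kill _ g) => //.
    by apply/p0; rewrite rmorphB /= -sK subrr.
  have [||||h hE] := @lrmorphism_of k Q B (g \o s).
  - by move=> a b; rewrite /= -rmorphD -[RHS]sE rmorphD /= -!sK.
  - by rewrite /= -(rmorph1 p) sE rmorph1.
  - by move=> a b; rewrite /= -rmorphM -[RHS]sE rmorphM /= -!sK.
  - by move=> c a; rewrite /= -linearZ -[RHS]sE linearZ /= -!sK.
  by exists h => a; rewrite hE /= sE.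
have fgQ : fg_algebra Q.
  apply: (@fg_extension _ _ p [::]) => // S Sp _ _ _ b.
  by have [a ->] := p_surj b.
have [h0 h0E] := lift _ _ g0I.
have [|C [l locC]] := @localization_exists Q (p f).
  move=> n E; have /eqP := oner_neq0 B0; apply.
  by rewrite -(expr1n _ n) -g0f -h0E exprMn -rmorphXn E rmorph0 mul0r.
exists C, (l \o p : {lrmorphism A -> C}); split.
- exact: fg_localization locC fgQ.
- split; last by case: locC.
  by move=> a aI; rewrite /= (p0 a).2 ?rmorph0 //; apply: combination_gen.
- move=> B g gI [b gf]; have [h hE] := lift _ _ gI.
  have [|h' h'E] := localization_lift locC (g := h).
    by exists b; rewrite hE.
  by exists h' => a; rewrite /= h'E hE.
- move=> B g h gh; apply: (localization_epi locC) => b.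
  by have [a ->] := p_surj b; apply: gh.
Qed.

End Constructions.

(** * Locally closed subschemes *)

Lemma unit_of_field_points (k : fieldType) (A : comAlgType k) (a : A) :
  (forall (K : comAlgType k) (e : {lrmorphism A -> K}), is_field_alg K -> e a <> 0) ->
  exists b, a * b = 1.
Proof.
move=> ea; have [|n [c [s [sa <-]]]] := (generates_unitP (eq a)).2.
  by move=> K e fK; exists a => //; apply: ea.
exists (\sum_i c i); rewrite mulr_sumr; apply: eq_bigr => i _.
by rewrite mulrC -sa.
Qed.

Lemma unit_neq0 (k : fieldType) (A B : comAlgType k) (g : {lrmorphism A -> B}) (a : A) :
  (exists b, a * b = 1) -> g a <> 0.
Proof.
case=> b ab ga; have /eqP := oner_neq0 B; apply.
by rewrite -(rmorph1 g) -ab rmorphM /= ga mul0r.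
Qed.

Lemma field_unit (k : fieldType) (K : comAlgType k) (a : K) :
  is_field_alg K -> a <> 0 -> exists b, a * b = 1.
Proof. by move=> fK /eqP; apply: fK. Qed.

(** * Gluing along a cover by localizations *)

Section StructureSheaf.
Variables (k : fieldType) (A : comAlgType k) (n : nat) (f : 'I_n -> A)
  (B : 'I_n -> comAlgType k) (l : forall i, {lrmorphism A -> B i}).
Hypotheses (genf : generates_unit (fun a => exists i, a = f i))
  (locl : forall i, is_localization (f i) (l i)).

Lemma cover_field_point (K : comAlgType k) (e : {lrmorphism A -> K}) :
  is_field_alg K -> exists i (h : {lrmorphism B i -> K}), forall a, h (l i a) = e a.
Proof.
move=> fK; have [_ [i ->] efi] := (generates_unitP _).1 genf K e fK.
exists i; apply: (localization_lift (locl i)); exact: field_unit.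
Qed.

Lemma generates_unit_powers (m : 'I_n -> nat) :
  generates_unit (fun a => exists i, a = f i ^+ m i).
Proof.
apply/generates_unitP => K e fK.
have [_ [i ->] efi] := (generates_unitP _).1 genf K e fK.
exists (f i ^+ m i); first by exists i.
by rewrite rmorphXn; apply: field_alg_expf_neq0.
Qed.

(** The difference is killed by some power of each [f i], and these powers still generate the unit
    ideal. *)
Lemma cover_separated (a b : A) : (forall i, l i a = l i b) -> a = b.
Proof.
move=> lab; apply/eqP; rewrite -subr_eq0; apply/eqP.
have ker i : exists m, f i ^+ m * (a - b) = 0.
  by case: (locl i) => _ _; apply; rewrite rmorphB /= lab subrr.
have [m mP] := choice ker; have [N [c [s [sP c1]]]] := generates_unit_powers m.
rewrite -(mul1r (a - b)) -c1 mulr_suml big1 // => j _.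
by have [i ->] := sP j; rewrite -mulrA mP mulr0.
Qed.

(** Each [b i] is a fraction a_i / g_i. Multiplying numerators and denominators by f_i^M, for one
    exponent M large enough for all pairs, makes the cross products agree in A itself; a partition
    of unity in the new denominators then combines the numerators. *)
Lemma cover_glue (b : forall i, B i) :
    (forall i j (C : comAlgType k) (u : {lrmorphism B i -> C})
       (v : {lrmorphism B j -> C}), u \o l i =1 v \o l j -> u (b i) = v (b j)) ->
  exists a, forall i, l i a = b i.
Proof.
move=> compat.
have frac i : exists p : nat * A, l i (f i) ^+ p.1 * b i = l i p.2.
  by case: (locl i) => _ + _ => /(_ (b i))[m [a E]]; exists (m, a).
have [p pP] := choice frac.
pose g i := f i ^+ (p i).1; pose a i := (p i).2.
have agree (ij : 'I_n * 'I_n) : exists m,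
    (f ij.1 * f ij.2) ^+ m * (g ij.2 * a ij.1 - g ij.1 * a ij.2) = 0.
  case: ij => i j /=.
  (* If f_i f_j is nilpotent, the overlap is empty and its coordinate algebra would be zero; the
     power that vanishes then serves as [m]. *)
  have [[m E]|nil] := pselect (exists m, (f i * f j) ^+ m = 0).
    by exists m; rewrite E mul0r.
  have [m E|C [lC locC]] := @localization_exists k A (f i * f j).
    by apply: nil; exists m.
  case: (locC) => [[d dE] _ ker]; apply: ker.
  have [|u uE] := localization_lift (locl i) (g := lC).
    by exists (lC (f j) * d); rewrite mulrA -rmorphM.
  have [|v vE] := localization_lift (locl j) (g := lC).
    by exists (lC (f i) * d); rewrite mulrA -rmorphM (mulrC (f j)).
  have uv : u (b i) = v (b j) by apply: compat => c /=; rewrite uE vE.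
  rewrite rmorphB !rmorphM /= -(uE (a i)) -(vE (a j)) /a -!pP !rmorphM !rmorphXn /=.
  by rewrite uE vE uv mulrCA subrr.
have [m mP] := choice agree.
pose M := (\max_ij m ij)%N.
have leM ij : (m ij <= M)%N by apply: (leq_bigmax (F := m)).
pose G i := f i ^+ M * g i; pose a' i := f i ^+ M * a i.
have GE i j : G j * a' i = G i * a' j.
  apply/eqP; rewrite -subr_eq0 /G /a' mulrACA (mulrACA (f i ^+ M)).
  rewrite (mulrC (f j ^+ M)) -mulrBr -exprMn.
  by rewrite -(subnK (leM (i, j))) exprD -mulrA mP mulr0.
have [N [c [s [sP c1]]]] := generates_unit_powers (fun i => M + (p i).1)%N.
have [t tE] := choice sP.
have {}tE j : s j = G (t j) by rewrite tE exprD.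
exists (\sum_j c j * a' (t j)) => i.
have {}lG : l i (G i) * l i (\sum_j c j * a' (t j)) = l i (G i) * b i.
  rewrite -rmorphM mulr_sumr (eq_bigr (fun j => c j * s j * a' i)).
    by rewrite -mulr_suml c1 mul1r !rmorphM !rmorphXn /= -mulrA pP.
  by move=> j _; rewrite tE mulrCA GE mulrA.
have [[d dE] _ _] := locl i.
move: lG => /(congr1 ( *%R (d ^+ (M + (p i).1)%N))).
by rewrite /G -exprD rmorphXn !mulrA -exprMn (mulrC d) dE expr1n !mul1r.
Qed.

End StructureSheaf.

Section Schemes.
Variable k : fieldType.
Implicit Types (X Y Z : functor k) (A B C K : comAlgType k).

(** An immersion is a monic morphism whose image satisfies this condition. It concerns points in all
    algebras, so it determines a subscheme with its structure and not only a set of field-valued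
    points. *)
Definition locally_closed X (P : point_set X) : Prop :=
  forall A (x : X A), exists I J : seq A, forall B (f : {lrmorphism A -> B}),
    P B (pmap f x) <-> vanish f I /\ generate f J.

Lemma pmap_pmap X A B C (f : {lrmorphism A -> B}) (g : {lrmorphism B -> C})
    (h : {lrmorphism A -> C}) (x : X A) :
  (forall a, g (f a) = h a) -> pmap g (pmap f x) = pmap h x.
Proof.
move=> gf; rewrite -pmap_comp; congr pmap.
exact: lrmorphism_ext.
Qed.

Lemma generate_comp A B C (f : {lrmorphism A -> B}) (g : {lrmorphism B -> C}) J :
  generate f J -> generate (g \o f) J.
Proof.
move=> /generateP hJ; apply/(@generateP k A C (g \o f : {lrmorphism A -> C})) => K e fK.
have [a aJ ea] := hJ K (e \o g : {lrmorphism B -> K}) fK.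
by exists a.
Qed.

Lemma locally_closed_stable X (P : point_set X) A B (f : {lrmorphism A -> B}) x :
  locally_closed P -> P A x -> P B (pmap f x).
Proof.
move=> lcP; have [I [J IJ]] := lcP A x.
rewrite -{1}[x]pmap_id => /IJ[van gen]; apply/IJ; split.
  by move=> a /van /= ->; rewrite rmorph0.
exact: (@generate_comp A A B (idfun : {lrmorphism A -> A}) f).
Qed.

(** Equations can be checked on a cover by [cover_separated]; the open condition is checked at
    field-valued points, each of which factors through a member of the cover. *)
Lemma locally_closed_local X (P : point_set X) A n (f : 'I_n -> A)
    (B : 'I_n -> comAlgType k) (l : forall i, {lrmorphism A -> B i}) (x : X A) :
    generates_unit (fun a => exists i, a = f i) ->
    (forall i, is_localization (f i) (l i)) -> locally_closed P ->
  (forall i, P _ (pmap (l i) x)) -> P _ x.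
Proof.
move=> genf locl lcP Pl; have [I [J IJ]] := lcP A x.
rewrite -[x]pmap_id; apply/IJ; split=> [a aI|].
  apply: (cover_separated genf locl) => i /=.
  by have [-> //] := (IJ _ _).1 (Pl i); rewrite rmorph0.
apply/(@generateP k A A (idfun : {lrmorphism A -> A})) => K e fK.
have [i [h hE]] := cover_field_point genf locl e fK.
have [_ /generateP hJ] := (IJ _ _).1 (Pl i).
by have [a aJ ha] := hJ K h fK; exists a => //; rewrite /= -hE.
Qed.

Lemma pmap_sub_stable X (P : point_set X) (lcP : locally_closed P) A B
  (f : {lrmorphism A -> B}) (x : {x : X A | P A x}) : P B (pmap f (proj1_sig x)).
Proof. exact: locally_closed_stable (proj2_sig x). Qed.

Program Definition subfunctor X (P : point_set X) (lcP : locally_closed P) : functor k :=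
  {| points := fun A => {x : X A | P A x};
     pmap := fun A B f x => exist _ (pmap f (proj1_sig x)) (pmap_sub_stable lcP f x) |}.
Next Obligation. by apply: eq_exist; rewrite /= pmap_id. Qed.
Next Obligation. by apply: eq_exist; rewrite /= pmap_comp. Qed.

Lemma sub_eq X (P : point_set X) (lcP : locally_closed P) A (x y : subfunctor lcP A) :
  proj1_sig x = proj1_sig y -> x = y.
Proof. by case: x y => [x Px] [y Py] /= E; apply: eq_exist. Qed.

Lemma sub_sheaf X (P : point_set X) (lcP : locally_closed P) :
  zariski_sheaf X -> zariski_sheaf (subfunctor lcP).
Proof.
move=> shX A n f B l genf locl x compat.
have [i j C u v uv|y [yE yU]] := shX A n f B l genf locl (fun i => proj1_sig (x i)).
  exact: (congr1 (@proj1_sig _ _) (compat i j C u v uv)).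
have Py : P A y.
  by apply: (locally_closed_local genf locl lcP) => i; rewrite yE; apply: proj2_sig.
exists (exist _ y Py : subfunctor lcP A); split=> [i|z zE]; first exact: sub_eq.
by apply: sub_eq; apply: yU => i; rewrite -zE.
Qed.

(** The charts only have to reach the points of [Q], so covers can be assembled piece by piece.
    Dependent pairs allow two families to be concatenated. *)
Definition covered X (Q : point_set X) : Prop :=
  exists (n : nat) (c : 'I_n -> {A : comAlgType k & morphism (Spec A) X}),
  [/\ forall i, fg_algebra (projT1 (c i)), forall i, open_immersion (projT2 (c i))
    & forall K (x : X K), is_field_alg K -> Q K x ->
        exists i, in_image (projT2 (c i)) x].

Lemma covered_big X (T : eqType) (s : seq T) (Q : T -> point_set X) :
  (forall t, t \in s -> covered (Q t)) ->
  covered (fun K x => exists2 t, t \in s & Q t K x).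
Proof.
elim: s => [|t s IHs] cQ.
  by exists 0%N, (fun i : 'I_0 => match notF (ltn_ord i) with end); split=> [[]|[]|K x _ []].
have [|n [c [fgc openc covc]]] := IHs; first by move=> t' ts; apply: cQ; rewrite inE ts orbT.
have [|m [d [fgd opend covd]]] := cQ t; first by rewrite inE eqxx.
exists (n + m)%N, (fun i => match fintype.split i with inl j => c j | inr j => d j end).
split=> [i|i|K x fK [t']]; try by case: (fintype.split i).
rewrite inE => /predU1P[-> Qx|ts Qx].
  have [i xi] := covd K x fK Qx; exists (rshift n i).
  by rewrite (unsplitK (inr i)).
have [i xi] := covc K x fK (ex_intro2 _ _ t' ts Qx); exists (lshift m i).
by rewrite (unsplitK (inl i)).
Qed.

Lemma coveredW X (P Q : point_set X) :
  (forall K x, is_field_alg K -> Q K x -> P K x) -> covered P -> covered Q.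
Proof.
move=> QP [n [c [fgc openc covc]]]; exists n, c; split=> // K x fK Qx.
by apply: covc => //; apply: QP.
Qed.

(** Yoneda: a morphism from a spectrum is its value at the universal point. *)
Lemma mor_spec X A (u : morphism (Spec A) X) B (f : {lrmorphism A -> B}) :
  u B f = pmap f (u A (idfun : {lrmorphism A -> A})).
Proof. by rewrite -mor_nat /=; congr (u B _); apply: lrmorphism_ext. Qed.

(** * Affine charts of a locally closed subfunctor *)

Section SubChart.
Variables (X : functor k) (P : point_set X) (lcP : locally_closed P)
  (A0 : comAlgType k) (u : morphism (Spec A0) X) (I J : seq A0) (f : A0).
Hypotheses (fgA0 : fg_algebra A0) (openu : open_immersion u) (fJ : f \in J).
Hypothesis IJ : forall B (g : {lrmorphism A0 -> B}),
  P (u B g) <-> vanish g I /\ generate g J.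

Section NonEmpty.
Variables (C : comAlgType k) (q : {lrmorphism A0 -> C}).
Hypotheses (fgC : fg_algebra C) (qI : vanish q I) (qf : exists b, q f * b = 1).
Hypothesis liftC : forall B (g : {lrmorphism A0 -> B}), vanish g I ->
  (exists b, g f * b = 1) ->
  exists h : {lrmorphism C -> B}, forall a, h (q a) = g a.
Hypothesis epiC : forall B (g h : {lrmorphism C -> B}),
  (forall a, g (q a) = h (q a)) -> forall c, g c = h c.

Lemma sub_chart_subproof B (h : {lrmorphism C -> B}) :
  P (u B (h \o q : {lrmorphism A0 -> B})).
Proof.
apply/IJ; split=> [a aI|]; first by rewrite /= qI ?rmorph0.
apply/(@generateP k A0 B (h \o q : {lrmorphism A0 -> B})) => K e fK; exists f => //.
exact: (@unit_neq0 k C K (e \o h : {lrmorphism C -> K})).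
Qed.

Definition sub_chart_fun B (h : Spec C B) : subfunctor lcP B :=
  exist _ (u B (h \o q : {lrmorphism A0 -> B})) (sub_chart_subproof h).

Lemma sub_chart_nat A B (g : {lrmorphism A -> B}) (h : Spec C A) :
  sub_chart_fun (pmap g h) = pmap g (sub_chart_fun h).
Proof.
apply: sub_eq; rewrite /= -mor_nat /=; congr (u B _).
exact: lrmorphism_ext.
Qed.

Definition sub_chart : morphism (Spec C) (subfunctor lcP) := Morphism sub_chart_nat.

(** Pulled back to Spec A, the chart [u] becomes D(J'). On each D(h) with [h] in J', the point [x]
    comes from A0, and there [f] becomes a fraction with numerator [a h]. The locus sought is thus
    the union of the D(h * a h). *)
Lemma sub_chart_open : open_immersion sub_chart.
Proof.
have [monu openu'] := openu.
split=> [A g h /(congr1 (@proj1_sig _ _)) /= /monu gh|A x].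
  apply: lrmorphism_ext; apply: epiC => a.
  exact: (congr1 (fun g : {lrmorphism A0 -> A} => g a) gh).
have [J' J'E] := openu' A (proj1_sig x).
(* The numerator over D(h), tested at field-valued points. The value 0 is a default for [h] outside
   J' and for nilpotent [h], where D(h) is empty. *)
have numer (h : A) : exists a, h \in J' ->
    forall K (e : {lrmorphism A -> K}) (p : {lrmorphism A0 -> K}), is_field_alg K ->
      e h <> 0 -> u K p = pmap e (proj1_sig x) -> (e (h * a) <> 0 <-> p f <> 0).
  have [[n hn]|nil] := pselect (exists n, h ^+ n = 0).
    exists 0 => _ K e p fK eh; case: (field_alg_expf_neq0 (n := n) fK eh).
    by rewrite -rmorphXn hn rmorph0.
  have [n hn|L [l locL]] := @localization_exists k A h; first by apply: nil; exists n.
  have [hJ'|nhJ'] := boolP (h \in J'); last by exists 0.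
  have [[b hb] frac _] := locL.
  have [|p pE] := (J'E L l).2.
    apply/generateP => K e fK; exists h => //; apply: unit_neq0.
    by exists b.
  have [n [a aE]] := frac (p f); exists a => _ K e r fK eh rE.
  have [|e' e'E] := localization_lift locL (g := e); first exact: field_unit.
  have re' : r = (e' \o p : {lrmorphism A0 -> K}).
    apply: monu; rewrite rE -(pmap_pmap (f := l) (g := e')) // -pE -mor_nat.
    by congr (u K _); apply: lrmorphism_ext.
  have ea : e a = e h ^+ n * r f.
    by rewrite re' -!e'E -aE rmorphM rmorphXn /=.
  rewrite rmorphM /= ea; split=> [neq0 rf0|rf0].
    by apply: neq0; rewrite rf0 !mulr0.
  by do 2 case/(field_algP fK) => //; apply: field_alg_expf_neq0.
have [a aP] := choice numer.
exists [seq h * a h | h <- J'] => B g; split=> [[h hE]|gen].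
  have xE : u B (h \o q : {lrmorphism A0 -> B}) = pmap g (proj1_sig x).
    exact: (congr1 (@proj1_sig _ _) hE).
  have /generateP genJ' : generate g J' by apply/J'E; exists (h \o q : {lrmorphism A0 -> B}).
  apply/generateP => K e fK; have [b bJ' eb] := genJ' K e fK.
  exists (b * a b); first by apply/mapP; exists b.
  apply/(aP b bJ' K (e \o g : {lrmorphism A -> K})
    ((e \o h : {lrmorphism C -> K}) \o q : {lrmorphism A0 -> K})) => //.
    rewrite pmap_comp -xE -mor_nat; congr (u K _); exact: lrmorphism_ext.
  exact: (@unit_neq0 k C K (e \o h : {lrmorphism C -> K})).
have {}gen K (e : {lrmorphism B -> K}) : is_field_alg K ->
    exists2 b, b \in J' & e (g (b * a b)) <> 0.
  by move=> fK; have [_ /mapP[b bJ' ->] eb] := (generateP _ _).1 gen K e fK; exists b.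
have eg K (e : {lrmorphism B -> K}) b : e (g (b * a b)) <> 0 -> e (g b) <> 0.
  by rewrite !rmorphM /= => + eb; apply; rewrite eb mul0r.
have /J'E[p pE] : generate g J'.
  by apply/generateP => K e fK; have [b bJ' /eg eb] := gen K e fK; exists b.
have Pgx : P (u B p) by rewrite pE; apply: pmap_sub_stable.
have [pI _] := (IJ p).1 Pgx.
have [|h hE] := liftC pI.
  apply: unit_of_field_points => K e fK; have [b bJ' eb] := gen K e fK.
  apply/(aP b bJ' K (e \o g : {lrmorphism A -> K}) (e \o p : {lrmorphism A0 -> K})) => //.
    exact: eg.
  by rewrite pmap_comp -pE -mor_nat.
exists h; apply: sub_eq; rewrite /= -pE; congr (u B _); exact: lrmorphism_ext.
Qed.

End NonEmpty.

Lemma sub_chart_covered : covered (fun K (x : subfunctor lcP K) =>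
  exists2 p : {lrmorphism A0 -> K}, u K p = proj1_sig x & p f <> 0).
Proof.
(* A piece with no point in any algebra has no nonzero coordinate algebra; the empty family of
   charts covers it. *)
have [[B [g [gI gf]]]|empty] := pselect (exists B (g : {lrmorphism A0 -> B}),
    vanish g I /\ exists b, g f * b = 1); last first.
  exists 0%N, (fun i : 'I_0 => match notF (ltn_ord i) with end).
  split=> [[]|[]|K x fK [p pE pf]] //; case: empty; exists K, p; split.
    by apply (IJ p).1; rewrite pE; apply: proj2_sig.
  exact: field_unit.
have [C [q [fgC [qI qf] liftC epiC]]] := affine_piece_exists gI gf fgA0.
exists 1%N, (fun=> existT _ C (sub_chart qI qf)); split=> // [_|K x fK [p pE pf]].
  exact: sub_chart_open.
have [||h hE] := liftC K p.
- by apply (IJ p).1; rewrite pE; apply: proj2_sig.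
- exact: field_unit.
exists ord0, h; apply: sub_eq; rewrite /= -pE; congr (u K _); exact: lrmorphism_ext.
Qed.

End SubChart.

(** On a chart of [X], evaluating [P] at the universal point gives one pair I, J. The trace of [P]
    is then the union over f in J of the affine pieces of V(I) where f is invertible. *)
Lemma sub_cover (X : scheme_ft k) (P : point_set X) (lcP : locally_closed P) :
  exists (n : nat) (A0 : 'I_n -> comAlgType k)
      (u : forall i, morphism (Spec (A0 i)) (subfunctor lcP)),
    [/\ forall i, fg_algebra (A0 i), forall i, open_immersion (u i)
      & forall K (x : subfunctor lcP K), is_field_alg K -> exists i, in_image (u i) x].
Proof.
suff [n [c [fgc openc covc]]] : covered (fun K (x : subfunctor lcP K) => True).
  exists n, (fun i => projT1 (c i)), (fun i => projT2 (c i)); split=> // K x fK.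
  exact: covc.
have [n [A0 [u [fgA openu covu]]]] := scheme_cover X.
pose Q i K (x : subfunctor lcP K) := in_image (u i) (proj1_sig x).
apply: (@coveredW _ (fun K x => exists2 i, i \in enum 'I_n & Q i K x)) => [K x fK _|].
  have [i ix] := covu K (proj1_sig x) fK.
  by exists i => //; rewrite mem_enum.
apply: covered_big => i _.
have [I [J IJ]] := lcP _ (u i (A0 i) (idfun : {lrmorphism A0 i -> A0 i})).
have IJ' B (g : {lrmorphism A0 i -> B}) : P _ (u i B g) <-> vanish g I /\ generate g J.
  by rewrite mor_spec.
pose R f K (x : subfunctor lcP K) :=
  exists2 p : {lrmorphism A0 i -> K}, u i K p = proj1_sig x & p f <> 0.
apply: (@coveredW _ (fun K x => exists2 f, f \in J & R f K x)) => [K x fK [p pE]|].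
  have [_ /generateP gen] : vanish p I /\ generate p J.
    by apply/IJ'; rewrite pE; apply: proj2_sig.
  by have [f fJ pf] := gen K (idfun : {lrmorphism K -> K}) fK; exists f => //; exists p.
apply: covered_big => f fJ; exact: (sub_chart_covered lcP (fgA i) (openu i) fJ IJ').
Qed.

Definition sub_scheme (X : scheme_ft k) (P : point_set X) (lcP : locally_closed P) :
  scheme_ft k := SchemeFT (sub_sheaf (lcP := lcP) (@scheme_sheaf k X)) (sub_cover lcP).

Lemma spec_sheaf A0 : zariski_sheaf (Spec A0).
Proof.
move=> A n f B l genf locl x compat.
have glue a0 : exists a, forall i, l i a = x i a0.
  apply: (cover_glue genf locl) => i j C u v uv.
  exact: (congr1 (fun g : {lrmorphism A0 -> C} => g a0) (compat i j C u v uv)).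
have [y yE] := choice glue.
have yU a0 a : (forall i, l i a = x i a0) -> y a0 = a.
  by move=> la; apply: (cover_separated genf locl) => i; rewrite la yE.
have [||||h hE] := @lrmorphism_of k A0 A y.
- by move=> a b; apply: yU => i; rewrite !rmorphD /= !yE.
- by apply: yU => i; rewrite !rmorph1.
- by move=> a b; apply: yU => i; rewrite !rmorphM /= !yE.
- by move=> c a; apply: yU => i; rewrite !linearZ /= !yE.
exists h; split=> [i|h' h'E].
  by apply: lrmorphism_ext => a; rewrite /= hE yE.
apply: lrmorphism_ext => a; rewrite hE; apply: yU => i.
exact: (congr1 (fun g : {lrmorphism A0 -> B i} => g a) (h'E i)).
Qed.

Definition id_morphism X : morphism X X :=
  @Morphism k X X (fun A x => x) (fun A B f x => erefl).

Lemma id_open X : open_immersion (id_morphism X).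
Proof.
split=> [A x y //|A x]; exists [:: 1] => B f; split=> [_|_]; last by exists (pmap f x).
by apply/generateP => K g fK; exists 1; rewrite ?inE // !rmorph1; apply/eqP/oner_neq0.
Qed.

Lemma spec_cover A0 : fg_algebra A0 ->
  exists (n : nat) (B : 'I_n -> comAlgType k)
      (u : forall i, morphism (Spec (B i)) (Spec A0)),
    [/\ forall i, fg_algebra (B i), forall i, open_immersion (u i)
      & forall K (x : Spec A0 K), is_field_alg K -> exists i, in_image (u i) x].
Proof.
move=> fgA; exists 1%N, (fun=> A0), (fun=> id_morphism (Spec A0)).
split=> // [_|K x fK]; first exact: id_open.
by exists ord0, x.
Qed.

Definition spec_scheme A0 (fgA : fg_algebra A0) : scheme_ft k :=
  SchemeFT (@spec_sheaf A0) (spec_cover fgA).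

End Schemes.

(** * Classes in K_0 and scissor relations *)

Section K0Monoid.
Variable k : fieldType.

Definition K0_repr (a : K0_term k) : K0_term k := epsilon (inhabits K0_zero) (K0_eq a).

(** Equivalent terms have equal classes as predicates, by extensionality, and [epsilon] depends only
    on the predicate. *)
Lemma K0_reprP (a b : K0_term k) : K0_eq a b <-> K0_repr a = K0_repr b.
Proof.
have reprE c : K0_eq c (K0_repr c) by apply: epsilon_spec; exists c; apply: K0_refl.
split=> [ab|E]; last by apply: K0_trans (reprE a) _; rewrite E; apply/K0_sym/reprE.
rewrite /K0_repr; congr (epsilon _ _); apply/funext => c; apply/propext.
by split; apply: K0_trans => //; apply: K0_sym.
Qed.

Lemma K0_repr_eq (a : K0_term k) : K0_eq (K0_repr a) a.
Proof. by apply: K0_sym; apply: epsilon_spec; exists a; apply: K0_refl. Qed.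

(* Canonical representatives turn the setoid of classes into a type with Leibniz equality. *)
Definition K0 : Type := {a : K0_term k | K0_repr a = a}.

Definition K0_of (a : K0_term k) : K0 :=
  exist _ (K0_repr a) ((K0_reprP (K0_repr a) a).1 (K0_repr_eq a)).

Lemma K0_ofP (a b : K0_term k) : K0_eq a b <-> K0_of a = K0_of b.
Proof.
split=> [/K0_reprP E|/(congr1 (@proj1_sig _ _))/K0_reprP//].
exact: eq_exist.
Qed.

Lemma K0_ofK (x : K0) : K0_of (proj1_sig x) = x.
Proof. by case: x => a aE; apply: eq_exist. Qed.

Definition K0_0 : K0 := K0_of K0_zero.
Definition K0_plus (x y : K0) : K0 := K0_of (K0_add (proj1_sig x) (proj1_sig y)).

Lemma K0_of_add a b : K0_of (K0_add a b) = K0_plus (K0_of a) (K0_of b).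
Proof. by apply/K0_ofP/K0_cong_add; apply/K0_sym/K0_repr_eq. Qed.

Lemma K0_plusA : associative K0_plus.
Proof.
move=> x y z; rewrite -(K0_ofK x) -(K0_ofK y) -(K0_ofK z) -!K0_of_add.
exact/K0_ofP/K0_addA.
Qed.

Lemma K0_plusC : commutative K0_plus.
Proof. by move=> x y; apply/K0_ofP/K0_addC. Qed.

Lemma K0_plus0 : left_id K0_0 K0_plus.
Proof.
by move=> x; rewrite -(K0_ofK x) /K0_0 -K0_of_add; apply/K0_ofP/K0_add0.
Qed.

HB.instance Definition _ := Monoid.isComLaw.Build K0 K0_0 K0_plus
  K0_plusA K0_plusC K0_plus0.

Lemma K0_of_sum (I : Type) (r : seq I) (F : I -> K0_term k) :
  K0_of (\big[@K0_add k/K0_zero]_(i <- r) F i) = \big[K0_plus/K0_0]_(i <- r) K0_of (F i).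
Proof. by apply: (big_morph K0_of K0_of_add). Qed.

Lemma K0_plusI (x y z : K0) : K0_plus x y = K0_plus x z -> y = z.
Proof.
have opp0 : K0_plus (K0_of (K0_opp (proj1_sig x))) x = K0_0.
  by rewrite -{2}(K0_ofK x) -K0_of_add; apply/K0_ofP/K0_addN.
by move=> /(congr1 (K0_plus (K0_of (K0_opp (proj1_sig x))))); rewrite !K0_plusA opp0 !K0_plus0.
Qed.

End K0Monoid.

(** * Closed, locally closed and complementary conditions on points *)

Section Predicates.
Variable k : fieldType.
Implicit Types (X Y Z : functor k) (A B C K : comAlgType k).

Lemma point_set_ext X (P Q : point_set X) : (forall A x, P A x <-> Q A x) -> P = Q.
Proof.
move=> PQ; apply/functional_extensionality_dep => A; apply/funext => x.
exact/propext.
Qed.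

Definition point_inter X (P Q : point_set X) : point_set X := fun A x => P A x /\ Q A x.

Definition closed_points X (P : point_set X) : Prop :=
  forall A (x : X A), exists I : seq A, forall B (f : {lrmorphism A -> B}),
    P B (pmap f x) <-> vanish f I.

(* On the points that are not field-valued this is stronger than the negation of [P]. *)
Definition avoid X (P : point_set X) : point_set X :=
  fun A x => forall B (f : {lrmorphism A -> B}), ~ P B (pmap f x).

Definition point_disjoint X (P Q : point_set X) : Prop :=
  forall K x, is_field_alg K -> P K x -> ~ Q K x.

Definition point_subset X (P Q : point_set X) : Prop := forall A x, P A x -> Q A x.

(** Equations are concatenated, while D(J) and D(J') meet in the locus of the products of their
    generators. *)
Lemma locally_closedI X (P Q : point_set X) :
  locally_closed P -> locally_closed Q -> locally_closed (point_inter P Q).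
Proof.
move=> lcP lcQ A x; have [I [J IJ]] := lcP A x; have [I' [J' IJ']] := lcQ A x.
exists (I ++ I'), [seq a * b | a <- J, b <- J'] => B f; split.
  case=> /IJ[fI /generateP fJ] /IJ'[fI' /generateP fJ']; split.
    by move=> a; rewrite mem_cat => /orP[/fI|/fI'].
  apply/generateP => K g fK.
  have [[a aJ ga] [b bJ' gb]] := (fJ K g fK, fJ' K g fK).
  exists (a * b); first exact: allpairs_f.
  by rewrite !rmorphM /= => /(field_algP fK)[].
case=> fI /generateP fJ; split; [apply/IJ | apply/IJ']; split.
- by move=> a aI; apply: fI; rewrite mem_cat aI.
- apply/generateP => K g /(fJ K g)[_ /allpairsP[[a b] /= [aJ _ ->]] gab].
  by exists a => //; apply: contra_not gab; rewrite !rmorphM /= => ->; rewrite mul0r.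
- by move=> a aI; apply: fI; rewrite mem_cat aI orbT.
- apply/generateP => K g /(fJ K g)[_ /allpairsP[[a b] /= [_ bJ ->]] gab].
  by exists b => //; apply: contra_not gab; rewrite !rmorphM /= => ->; rewrite mulr0.
Qed.

Lemma closed_locally_closed X (P : point_set X) : closed_points P -> locally_closed P.
Proof.
move=> cP A x; have [I IE] := cP A x; exists I, [:: 1] => B f.
split=> [/IE fI|[/IE //]]; split=> //.
apply/generateP => K g fK; exists 1; rewrite ?inE // !rmorph1.
by apply/eqP/oner_neq0.
Qed.

(** The complement of V(I) is D(I): where [I] fails to generate the unit ideal, all of it vanishes
    at some field-valued point, and conversely an algebra in which [I] vanishes has a residue
    field. *)
Lemma avoid_generate X (P : point_set X) A (x : X A) (I : seq A) :
    (forall B (f : {lrmorphism A -> B}), P B (pmap f x) <-> vanish f I) ->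
  forall B (f : {lrmorphism A -> B}), avoid P (pmap f x) <-> generate f I.
Proof.
move=> IE B f; split=> [avP|/generateP gen C g].
  apply/generateP => K g fK; apply: contrapT => none; apply: (avP K g).
  rewrite -pmap_comp; apply/IE => a aI; apply: contrapT => ga.
  by apply: none; exists a.
rewrite -pmap_comp => /IE van; have [K [fK [h]]] := residue_field C.
have [a aI] := gen K (h \o g : {lrmorphism B -> K}) fK; apply => /=.
by rewrite -[g (f a)]/((g \o f) a) van ?rmorph0.
Qed.

Lemma avoid_locally_closed X (P : point_set X) : closed_points P -> locally_closed (avoid P).
Proof.
move=> cP A x; have [I /avoid_generate IE] := cP A x; exists [::], I => B f.
by split=> [/IE|[_ /IE]].
Qed.

(** A nonzero element of a field is a unit and stays nonzero in every algebra, so a closed condition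
    that fails over a field fails after any base change. *)
Lemma avoid_field X (P : point_set X) K (x : X K) :
  closed_points P -> is_field_alg K -> avoid P x <-> ~ P K x.
Proof.
move=> cP fK; split=> [/(_ K (idfun : {lrmorphism K -> K}))|nPx B f]; first by rewrite pmap_id.
have [I IE] := cP K x => /IE fI; apply: nPx; rewrite -[x]pmap_id; apply/IE => a aI /=.
apply: contrapT => /(field_unit fK) /(unit_neq0 (g := f)); apply; exact: fI.
Qed.

Lemma pullback_closed X Y (t : morphism Y X) (P : point_set X) :
  closed_points P -> closed_points (fun A y => P A (t A y)).
Proof.
by move=> cP A y; have [I IE] := cP A (t A y); exists I => B f; rewrite mor_nat.
Qed.

Lemma pullback_locally_closed X Y (t : morphism Y X) (P : point_set X) :
  locally_closed P -> locally_closed (fun A y => P A (t A y)).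
Proof.
move=> lcP A y; have [I [J IE]] := lcP A (t A y).
by exists I, J => B f; rewrite mor_nat.
Qed.

Lemma pullback_avoid X Y (t : morphism Y X) (P : point_set X) :
  (fun A y => avoid P (t A y)) = avoid (fun A y => P A (t A y)).
Proof.
apply: point_set_ext => A y; split=> av B f; last by rewrite -mor_nat; apply: av.
by rewrite mor_nat; apply: av.
Qed.

Lemma all_consE X (W : eqType) (w : W) (s : seq W) (P : W -> point_set X) :
  (fun A x => forall w', w' \in w :: s -> P w' A x) =
  point_inter (P w) (fun A x => forall w', w' \in s -> P w' A x).
Proof.
apply: point_set_ext => A x; split=> [Px|[Pw Px] w'].
  by split=> [|w' ws]; apply: Px; rewrite inE ?eqxx ?ws ?orbT.
by rewrite inE => /predU1P[->|/Px].
Qed.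

Lemma locally_closed_all X (W : eqType) (s : seq W) (P : W -> point_set X) :
    (forall w, w \in s -> locally_closed (P w)) ->
  locally_closed (fun A x => forall w, w \in s -> P w A x).
Proof.
elim: s => [|w s IHs] lcP.
  by apply: closed_locally_closed => A x; exists [::].
rewrite all_consE; apply: locally_closedI; first by apply: lcP; rewrite inE eqxx.
by apply: IHs => w' ws; apply: lcP; rewrite inE ws orbT.
Qed.

Lemma image_locally_closed X Z (i : morphism Z X) :
  immersion i -> locally_closed (fun A x => in_image i x).
Proof. by case. Qed.

End Predicates.

(** * Classes of locally closed sets, additivity and cuts *)

Section Classes.
Variables (k : fieldType) (X : scheme_ft k).
Implicit Types (P Q : point_set X) (A B C K : comAlgType k).

Local Notation "x + y" := (K0_plus x y).

(* The junk value [0] is taken on the sets that are not locally closed. *)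
Definition class_of P : K0 k :=
  match pselect (locally_closed P) with
  | left lcP => K0_of (K0_class (sub_scheme lcP))
  | right _ => K0_0 k
  end.

Lemma class_ofE P (lcP : locally_closed P) :
  class_of P = K0_of (K0_class (sub_scheme lcP)).
Proof.
by rewrite /class_of; case: pselect => // lcP'; rewrite (Prop_irrelevance lcP' lcP).
Qed.

Definition inclusion_fun P Q (lcP : locally_closed P) (lcQ : locally_closed Q)
    (PQ : point_subset P Q) A (x : subfunctor lcP A) : subfunctor lcQ A :=
  exist _ (proj1_sig x) (PQ A _ (proj2_sig x)).

Lemma inclusion_nat P Q (lcP : locally_closed P) (lcQ : locally_closed Q)
    (PQ : point_subset P Q) A B (f : {lrmorphism A -> B}) (x : subfunctor lcP A) :
  inclusion_fun lcQ PQ (pmap f x) = pmap f (inclusion_fun lcQ PQ x).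
Proof. exact: sub_eq. Qed.

Definition inclusion P Q (lcP : locally_closed P) (lcQ : locally_closed Q)
    (PQ : point_subset P Q) : morphism (subfunctor lcP) (subfunctor lcQ) :=
  Morphism (inclusion_nat (lcP := lcP) lcQ PQ).

Lemma inclusion_image P Q (lcP : locally_closed P) (lcQ : locally_closed Q)
    (PQ : point_subset P Q) A (x : subfunctor lcQ A) :
  in_image (inclusion lcP lcQ PQ) x <-> P A (proj1_sig x).
Proof.
split=> [[z <-]|Px]; first exact: proj2_sig z.
by exists (exist _ (proj1_sig x) Px : subfunctor lcP A); apply: sub_eq.
Qed.

Lemma inclusion_monic P Q (lcP : locally_closed P) (lcQ : locally_closed Q)
  (PQ : point_subset P Q) : monic (inclusion lcP lcQ PQ).
Proof. by move=> A x y /(congr1 (@proj1_sig _ _)) /= E; apply: sub_eq. Qed.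

(** Every algebra maps to a field, so such a scheme has no points at all. It is then complementary
    to itself inside itself, whence a = a + a. *)
Lemma class_of_empty P : locally_closed P ->
  (forall K x, is_field_alg K -> ~ P K x) -> class_of P = K0_0 k.
Proof.
move=> lcP emptyP; rewrite (class_ofE lcP); apply/K0_ofP.
have noP A (x : subfunctor lcP A) : False.
  have [K [fK [f]]] := residue_field A; apply: (emptyP K) fK _.
  exact: (proj2_sig (pmap f x)).
set a := K0_class (sub_scheme lcP).
have h : K0_eq a (K0_add a a).
  apply: (@K0_scissor k (sub_scheme lcP) (sub_scheme lcP) (sub_scheme lcP)
    (id_morphism _) (id_morphism _)).
    by split=> [A x y //|A x]; case: (noP A x).
  by split=> [|A x]; [apply: id_open | case: (noP A x)].
apply: K0_trans (K0_sym (K0_add0 a)) _.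
apply: K0_trans (K0_cong_add (K0_sym (K0_addN a)) (K0_refl a)) _.
apply: K0_trans (K0_sym (K0_addA _ _ _)) _.
apply: K0_trans (K0_cong_add (K0_refl _) (K0_sym h)) _.
exact: K0_addN.
Qed.

Definition scissor_additive (F : point_set X -> K0 k) : Prop :=
  forall P Q, locally_closed P -> closed_points Q ->
    F P = F (point_inter P Q) + F (point_inter P (avoid Q)).

Lemma class_of_additive : scissor_additive class_of.
Proof.
move=> P Q lcP cQ.
have lcQ := locally_closedI lcP (closed_locally_closed cQ).
have lcA := locally_closedI lcP (avoid_locally_closed cQ).
rewrite (class_ofE lcP) (class_ofE lcQ) (class_ofE lcA) -K0_of_add; apply/K0_ofP.
have inQ : point_subset (point_inter P Q) P by move=> A x [].
have inA : point_subset (point_inter P (avoid Q)) P by move=> A x [].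
apply: (@K0_scissor k (sub_scheme lcP) (sub_scheme lcQ) (sub_scheme lcA)
  (inclusion lcQ lcP inQ) (inclusion lcA lcP inA)).
  split=> [|A x]; first exact: inclusion_monic.
  have [I IE] := cQ A (proj1_sig x); exists I => B f.
  rewrite inclusion_image -IE; split=> [[]//|Qfx]; split=> //.
  exact: (proj2_sig (pmap f x)).
split=> [|A x].
  split=> [|A x]; first exact: inclusion_monic.
  have [I /avoid_generate IE] := cQ A (proj1_sig x); exists I => B f.
  rewrite inclusion_image -IE; split=> [[]//|Qfx]; split=> //.
  exact: (proj2_sig (pmap f x)).
rewrite inclusion_image; split=> [[_ av] B f|av].
  by rewrite inclusion_image => -[_]; apply: av.
split=> [|B f Qfx]; first exact: (proj2_sig x).
apply: (av B f); rewrite inclusion_image; split=> //.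
exact: (proj2_sig (pmap f x)).
Qed.

(* Finitely many scissor relations separate [P] from its complement; stated in
   terms of additive functions, this needs no list of the pieces. *)
Definition cut P : Prop :=
  forall (F G : point_set X -> K0 k) Q, scissor_additive F -> scissor_additive G ->
    locally_closed Q ->
    (forall Q', locally_closed Q' -> point_subset Q' Q -> point_subset Q' P -> F Q' = G Q') ->
    (forall Q', locally_closed Q' -> point_subset Q' Q -> point_disjoint Q' P -> F Q' = G Q') ->
  F Q = G Q.

Lemma cut_closed P : closed_points P -> cut P.
Proof.
move=> cP F G Q addF addG lcQ inP offP; rewrite (addF Q P) // (addG Q P) //.
congr (_ + _).
  apply: inP => [|A x []|A x []] //; apply: locally_closedI => //.
  exact: closed_locally_closed.
apply: offP => [|A x []|K x fK [_]] //; last by move/avoid_field; apply.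
exact/locally_closedI/avoid_locally_closed.
Qed.

Lemma cut_avoid P : closed_points P -> cut (avoid P).
Proof.
move=> cP F G Q addF addG lcQ inP offP; rewrite (addF Q P) // (addG Q P) //.
congr (_ + _).
  apply: offP => [|A x []|K x fK [_ Px]] //; last by move/avoid_field; apply.
  by apply: locally_closedI => //; apply: closed_locally_closed.
apply: inP => [|A x []|A x []] //.
exact/locally_closedI/avoid_locally_closed.
Qed.

(** Cut along [P], then cut the part inside [P] along [P']. This composes because [cut] quantifies
    over all locally closed [Q]. *)
Lemma cutI P P' : cut P -> cut P' -> cut (point_inter P P').
Proof.
move=> cutP cutP' F G Q addF addG lcQ inP offP; apply: (cutP) => // Q1 lcQ1 Q1Q Q1P.
  apply: (cutP') => // Q2 lcQ2 Q2Q1 Q2P'.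
    by apply: inP => // A x Q2x; [apply/Q1Q/Q2Q1 | split; [apply/Q1P/Q2Q1 | apply: Q2P']].
  apply: offP => // [A x Q2x|K x fK Q2x [_]]; first exact/Q1Q/Q2Q1.
  exact: Q2P'.
by apply: offP => // K x fK Q1x [Px _]; apply: Q1P Px.
Qed.

Lemma cut_all (W : eqType) (s : seq W) (P : W -> point_set X) :
    (forall w, w \in s -> cut (P w)) ->
  cut (fun A x => forall w, w \in s -> P w A x).
Proof.
elim: s => [|w s IHs] cutP; first by apply: cut_closed => A x; exists [::].
rewrite all_consE; apply: cutI; first by apply: cutP; rewrite inE eqxx.
by apply: IHs => w' ws; apply: cutP; rewrite inE ws orbT.
Qed.

(** Induction on the pieces. The right-hand side is itself additive in [Q], so cutting along the
    first piece reduces the equality to sets inside that piece, where one term survives, and to sets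
    off it, which the remaining pieces partition. *)
Lemma class_of_partition (I : eqType) (s : seq I) (P : I -> point_set X) Q :
    locally_closed Q -> uniq s ->
    (forall i, i \in s -> locally_closed (P i) /\ cut (P i)) ->
    (forall K x, is_field_alg K -> Q K x -> exists2 i, i \in s & P i K x) ->
    (forall K x i j, is_field_alg K -> Q K x -> i \in s -> j \in s ->
       P i K x -> P j K x -> i = j) ->
  class_of Q = \big[@K0_plus k/K0_0 k]_(i <- s) class_of (point_inter Q (P i)).
Proof.
elim: s Q => [|i s IHs] Q lcQ /= us lcP covQ disQ.
  by rewrite big_nil; apply: class_of_empty => // K x fK /(covQ K x fK)[].
case/andP: us => nis us.
have lcPs j : j \in s -> locally_closed (P j) /\ cut (P j).
  by move=> js; apply: lcP; rewrite inE js orbT.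
have [|lcPi cutPi] := lcP i; first by rewrite inE eqxx.
pose G (Q : point_set X) := \big[@K0_plus k/K0_0 k]_(j <- i :: s) class_of (point_inter Q (P j)).
rewrite -/(G Q); apply: cutPi => //; first exact: class_of_additive.
- move=> R c lcR cc; rewrite /G -big_split /=; apply: eq_big_seq => j /lcP[lcPj _].
  rewrite (class_of_additive _ cc) //; last exact: locally_closedI.
  by congr (class_of _ + class_of _); apply: point_set_ext => A x; split=> [[[]]|[[]]].
- move=> R lcR RQ RP; rewrite /G big_cons big1_seq => [|j /andP[_ js]].
    rewrite K0_plusC K0_plus0; congr class_of; apply: point_set_ext => A x.
    by split=> [Rx|[]//]; split=> //; apply: RP.
  apply: class_of_empty => [|K x fK [Rx Pj]].
    by apply: locally_closedI => //; case: (lcPs j js).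
  have ij : i = j.
    apply: (disQ K x) => //; rewrite ?inE ?eqxx ?js ?orbT //.
      exact: RQ.
    exact: RP.
  by rewrite ij js in nis.
- move=> R lcR RQ RP; have Ri0 : class_of (point_inter R (P i)) = K0_0 k.
    apply: class_of_empty => [|K x fK [Rx]]; first exact: locally_closedI.
    exact: RP Rx.
  rewrite /G big_cons Ri0 K0_plus0; apply: IHs => // [K x fK Rx|K x j j' fK Rx js j's].
    have [j] := covQ K x fK (RQ K x Rx); rewrite inE => /predU1P[->|js Pj].
      by move/(RP K x fK Rx).
    by exists j.
  by apply: (disQ K x) => //; rewrite ?inE ?js ?j's ?orbT //; apply: RQ.
Qed.

End Classes.

Section Transport.
Variable k : fieldType.

(** Both sides are the fibre product of [Z] and [Y] over [X], seen once inside [Z] and once inside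
    [Y]. Naturality of the chosen bijection follows from [t] being monic. *)
Lemma class_of_fiber (X : functor k) (Z Y : scheme_ft k) (i : morphism Z X)
    (t : morphism Y X) : immersion i -> immersion t ->
  class_of (fun A z => in_image t (i A z)) = class_of (fun A y => in_image i (t A y)).
Proof.
move=> immi immt; have [moni _] := immi; have [mont _] := immt.
have lcZ := pullback_locally_closed i (image_locally_closed immt).
have lcY := pullback_locally_closed t (image_locally_closed immi).
rewrite (class_ofE lcZ) (class_ofE lcY); apply/K0_ofP/K0_iso.
have [F FE] : exists F : forall A, subfunctor lcZ A -> subfunctor lcY A,
    forall A z, t A (proj1_sig (F A z)) = i A (proj1_sig z).
  have ex (A : comAlgType k) (z : subfunctor lcZ A) :
      {y : subfunctor lcY A | t A (proj1_sig y) = i A (proj1_sig z)}.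
    apply: cid; have [y yE] := proj2_sig z.
    suff py : in_image i (t A y) by exists (exist _ y py).
    by rewrite yE; exists (proj1_sig z).
  by exists (fun A z => proj1_sig (ex A z)) => A z; apply: (proj2_sig (ex A z)).
have Fnat (A B : comAlgType k) (f : {lrmorphism A -> B}) (z : subfunctor lcZ A) :
    F B (pmap f z) = pmap f (F A z).
  by apply: sub_eq; apply: mont; rewrite FE /= !mor_nat FE.
exists (Morphism Fnat) => A.
have back (y : subfunctor lcY A) : exists z : subfunctor lcZ A,
    i A (proj1_sig z) = t A (proj1_sig y).
  have [z zE] := proj2_sig y; suff pz : in_image t (i A z) by exists (exist _ z pz).
  by rewrite zE; exists (proj1_sig y).
have [G GE] := boolp.choice back.
exists G => [z|y]; apply: sub_eq; [apply: moni | apply: mont].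
  by rewrite GE /= FE.
by rewrite /= FE GE.
Qed.

Lemma class_of_full (X : scheme_ft k) :
  class_of (fun A (x : X A) => True) = K0_of (K0_class X).
Proof.
have lcT : locally_closed (fun A (x : X A) => True).
  by apply: closed_locally_closed => A x; exists [::].
rewrite (class_ofE lcT); apply/K0_ofP/K0_iso.
have nat (A B : comAlgType k) (f : {lrmorphism A -> B}) (x : subfunctor lcT A) :
  proj1_sig (pmap f x) = pmap f (proj1_sig x) by [].
exists (@Morphism k (subfunctor lcT) X (fun A x => proj1_sig x) nat) => A.
by exists (fun x => exist _ x Logic.I : subfunctor lcT A) => [[x []]|].
Qed.

(** At the universal point a locally closed condition becomes a single pair I, J valid on the whole
    spectrum: V(I) intersected with the complement of V(J). *)
Lemma cut_spec (A0 : comAlgType k) (fgA : fg_algebra A0) (P : point_set (spec_scheme fgA)) :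
  locally_closed P -> cut P.
Proof.
move=> lcP; have [I [J IJ]] := lcP A0 (idfun : {lrmorphism A0 -> A0}).
pose V (L : seq A0) : point_set (spec_scheme fgA) :=
  fun B (g : {lrmorphism A0 -> B}) => vanish g L.
have cV L : closed_points (V L).
  move=> B g; exists (map g L) => C h; split=> [van b /mapP[a aL ->]|van a aL].
    exact: van.
  by apply: van; apply: map_f.
have idE (B : comAlgType k) (g : {lrmorphism A0 -> B}) :
    @pmap k (Spec A0) A0 B g (idfun : {lrmorphism A0 -> A0}) = g.
  exact: lrmorphism_ext.
have -> : P = point_inter (V I) (avoid (V J)).
  apply: point_set_ext => B g; rewrite -{1}(idE B g) IJ.
  have avJ : @avoid k (Spec A0) (V J) B g <-> generate g J.
    by rewrite -{1}(idE B g); apply: avoid_generate => C h; rewrite idE.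
  by split=> -[gI gJ]; split=> //; apply/avJ.
by apply: cutI; [apply: cut_closed | apply: cut_avoid].
Qed.

End Transport.

(** * Tori and coordinate strata *)

Section Laurent.
Variable k : fieldType.
Implicit Types (A B C K R : comAlgType k).

(** The universal property of the algebra of Laurent polynomials in [n] variables. Only the values
    of [t] below [n] matter. *)
Definition is_laurent (n : nat) R (t : nat -> R) : Prop :=
  [/\ fg_algebra R,
      forall i, (i < n)%N -> exists b, t i * b = 1,
      forall A (a : nat -> A), (forall i, (i < n)%N -> exists b, a i * b = 1) ->
        exists h : {lrmorphism R -> A}, forall i, (i < n)%N -> h (t i) = a i
    & forall A (g h : {lrmorphism R -> A}),
        (forall i, (i < n)%N -> g (t i) = h (t i)) -> forall r, g r = h r].

Lemma laurent_exists n : exists p : {R : comAlgType k & nat -> R}, is_laurent n (projT2 p).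
Proof.
elim: n => [|n [[R t] [fgR tU lift epi]]] /=.
  exists (existT _ (k^o : comAlgType k) (fun=> 1)); split=> // [|A a _|A g h _ r].
  - exact: fg_base.
  - have [||||h _] := @lrmorphism_of k (k^o : comAlgType k) A (fun c => c%:A).
    + by move=> c d; apply: scalerDl.
    + exact: scale1r.
    + by move=> c d; rewrite -scalerAl mul1r scalerA.
    + by move=> c d; rewrite scalerA.
    by exists h.
  - have rE : r = r *: (1 : k^o) by rewrite -[RHS]/(r * 1) mulr1.
    by rewrite rE !linearZ !rmorph1.
have [c cE] := poly_const R.
have [|L [l locL]] := @localization_exists k (poly_alg R) ('X : {poly R}).
  by move=> m; apply/eqP; apply: (monic_neq0 (monicXn R m)).
(* The variable adjoined and inverted last has index [n]; the larger indices receive it as a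
   default. *)
exists (existT _ L (fun i => if (i < n)%N then l (c (t i)) else l ('X : {poly R}))).
split=> [|i _|A a aU|A g h gh] /=.
- by apply: (fg_localization locL); apply: fg_poly.
- case: ltnP => [/tU[b tb]|_]; last by case: locL.
  by exists (l (c b)); rewrite -!rmorphM tb !rmorph1.
- have [|g gE] := lift A a; first by move=> i /ltnW; apply: aU.
  have [g' [g'C g'X]] := poly_lift g (a n).
  have [|h hE] := localization_lift locL (g := g'); first by rewrite g'X; apply: aU.
  exists h => i; rewrite ltnS leq_eqVlt => /predU1P[->|lt_in].
    by rewrite ltnn hE.
  by rewrite lt_in hE cE g'C gE.
- apply: (localization_epi locL).
  apply: (@poly_epi _ _ _ (g \o l : {lrmorphism poly_alg R -> A})
    (h \o l : {lrmorphism poly_alg R -> A})).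
    move=> r; rewrite -cE.
    apply: (epi A ((g \o l : {lrmorphism poly_alg R -> A}) \o c : {lrmorphism R -> A})
                  ((h \o l : {lrmorphism poly_alg R -> A}) \o c : {lrmorphism R -> A})) => i lt_in.
    by have := gh i (ltnW lt_in); rewrite /= lt_in.
  by have := gh n (ltnSn n); rewrite /= ltnn.
Qed.

Definition laurent_sig n := cid (laurent_exists n).
Definition laurent n : comAlgType k := projT1 (proj1_sig (laurent_sig n)).
Definition laurent_var n : nat -> laurent n := projT2 (proj1_sig (laurent_sig n)).

Lemma laurentP n : is_laurent n (@laurent_var n).
Proof. exact: (proj2_sig (laurent_sig n)). Qed.

Lemma fg_laurent n : fg_algebra (laurent n).
Proof. by case: (laurentP n). Qed.

Definition torus n : scheme_ft k := spec_scheme (fg_laurent n).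

Definition torus_class n : K0 k := K0_of (K0_class (torus n)).

End Laurent.

Section Lines.
Variables (k : fieldType) (W : finType).
Implicit Types (A B C K : comAlgType k).

Definition line A (u : {ffun W -> A}) : {ffun W -> A} -> Prop :=
  fun v => exists a, v = [ffun w => a * u w].

Lemma line_self A (u : {ffun W -> A}) : line u u.
Proof. by exists 1; apply/ffunP => w; rewrite ffunE mul1r. Qed.

Lemma line_proj_point A (u : {ffun W -> A}) w0 : u w0 = 1 -> proj_point (line u).
Proof.
move=> u1; split; first split.
- by exists 0; apply/ffunP => w; rewrite !ffunE mul0r.
- move=> _ _ [a ->] [b ->]; exists (a + b); apply/ffunP => w.
  by rewrite !ffunE mulrDl.
- move=> a _ [b ->]; exists (a * b); apply/ffunP => w.
  by rewrite !ffunE mulrA.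
- move=> _ _ [a ->] [b ->] w w'; rewrite !ffunE mulrACA [RHS]mulrACA.
  by rewrite (mulrC (u w)).
- exists 1%N, (fun=> 1), (fun=> 1); split=> [_|]; last by rewrite big_ord1 mulr1.
  by exists u, w0; split=> //; apply: line_self.
Qed.

Lemma line_inj A (u v : {ffun W -> A}) w0 : u w0 = 1 -> v w0 = 1 -> line u = line v -> u = v.
Proof.
move=> u1 v1 uv; have [a E] : line v u by rewrite -uv; apply: line_self.
have := congr1 (fun f : {ffun W -> A} => f w0) E; rewrite ffunE u1 v1 mulr1 => a1.
by rewrite E -a1; apply/ffunP => w; rewrite ffunE mul1r.
Qed.

(** The vanishing of the minors of u and v at w0, w reads v w = v w0 * u w, as u w0 = 1. *)
Lemma proj_point_line A (L : {ffun W -> A} -> Prop) u w0 :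
  proj_point L -> L u -> u w0 = 1 -> L = line u.
Proof.
move=> [[L0 LD LZ] minors _] Lu u1; apply/funext => v; apply/propext.
split=> [Lv|[a ->]]; last exact: LZ.
exists (v w0); apply/ffunP => w; rewrite ffunE (mulrC (v w0)).
by rewrite (minors _ _ Lu Lv) u1 mul1r.
Qed.

Lemma extend_line A B (f : {lrmorphism A -> B}) (u : {ffun W -> A}) w0 :
  u w0 = 1 -> extend_scalars f (line u) = line (map_vec f u).
Proof.
move=> u1; apply: (@proj_point_line _ _ _ w0); last by rewrite ffunE u1 rmorph1.
  exact/extend_proj_point/(line_proj_point u1).
by apply: sub_span; exists u => //; apply: line_self.
Qed.

Lemma proj_eq A (L M : proj_space k W A) : proj1_sig L = proj1_sig M -> L = M.
Proof. by case: L M => [L pL] [M pM] /= E; apply: eq_exist. Qed.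

Definition coord_vanish (w : W) : point_set (proj_space k W) :=
  fun A L => coord_zero L w.

(** Finitely many vectors of L have coordinates that generate the unit ideal. By the minors, the
    [w]-coordinate of any vector of L is a combination of the [w]-coordinates of these, which
    therefore serve as equations. *)
Lemma coord_vanish_closed w : closed_points (coord_vanish w).
Proof.
move=> A [L pL]; have [mL minors [n [c [s [sL c1]]]]] := pL.
have gens (i : 'I_n) : exists p : {ffun W -> A} * W, L p.1 /\ s i = p.1 p.2.
  by have [u [w' uw]] := sL i; exists (u, w').
have [p pP] := boolp.choice gens.
exists [seq (p i).1 w | i <- enum 'I_n] => B f; split=> [van _ /mapP[i _ ->]|van v /=].
  have := van (map_vec f (p i).1); rewrite ffunE; apply.
  by apply: sub_span; exists (p i).1 => //; case: (pP i).
have sub0 : submodule (fun v : {ffun W -> B} => v w = 0).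
  split=> [|a b a0 b0|a b b0]; rewrite !ffunE //.
    by rewrite a0 b0 addr0.
  by rewrite b0 mulr0.
move/(_ _ sub0); apply => _ [u Lu ->]; rewrite ffunE -(mul1r (u w)) -c1 mulr_suml.
rewrite rmorph_sum big1 // => i _; have [Lpi ->] := pP i.
have pi0 : f ((p i).1 w) = 0.
  by apply: van; apply/mapP; exists i; rewrite ?mem_enum.
by rewrite -mulrA (minors _ _ Lpi Lu) !rmorphM /= pi0 mul0r mulr0.
Qed.

(** With [avoid] in place of a negation the condition is stable under base change, so that it
    defines a subscheme. *)
Definition stratum (S : {set W}) : point_set (proj_space k W) :=
  fun A L => forall w, w \in enum W ->
    (if w \in S then avoid (coord_vanish w) else coord_vanish w) A L.

Lemma stratumE S A (L : proj_space k W A) : stratum S L <->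
  forall w, if w \in S then avoid (coord_vanish w) L else coord_zero L w.
Proof.
split=> SL w; first by have := SL w; rewrite mem_enum; case: ifP => _; apply.
by move=> _; have := SL w; case: ifP.
Qed.

Lemma stratum_locally_closed S : locally_closed (stratum S).
Proof.
apply: locally_closed_all => w _; case: ifP => _.
  exact/avoid_locally_closed/coord_vanish_closed.
exact/closed_locally_closed/coord_vanish_closed.
Qed.

(** On a possibly non-affine [Z] the cut is made one coordinate at a time, each coordinate giving a
    closed condition or the complement of one. *)
Lemma stratum_pullback_cut (Z : scheme_ft k) (i : morphism Z (proj_space k W)) S :
  cut (fun A z => stratum S (i A z)).
Proof.
pose P w : point_set Z := fun A z =>
  (if w \in S then avoid (coord_vanish w) else coord_vanish w) A (i A z).
apply: (@cut_all k Z W (enum W) P) => w _; rewrite /P.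
have cZ := pullback_closed i (@coord_vanish_closed w).
case: ifP => _; last exact: cut_closed.
by rewrite pullback_avoid; apply: cut_avoid.
Qed.

Lemma stratum_unique A (L : proj_space k W A) S S' : stratum S L -> stratum S' L -> S = S'.
Proof.
move=> /stratumE SL /stratumE SL'; apply/setP => w.
have excl : avoid (coord_vanish w) L -> ~ coord_zero L w.
  by move=> /(_ A (idfun : {lrmorphism A -> A})); rewrite pmap_id.
have := SL w; have := SL' w.
by case: (w \in S); case: (w \in S') => // ? ?; exfalso; apply: excl; eassumption.
Qed.

Lemma stratum_field K (L : proj_space k W K) S : is_field_alg K ->
  stratum S L <-> forall w, w \in S <-> coord_nonzero L w.
Proof.
move=> fK; rewrite stratumE; split=> SL w; have := SL w.
  case: (w \in S); first by move/(avoid_field _ (@coord_vanish_closed w) fK).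
  by move=> w0; split=> // /(_ w0).
case: (w \in S) => -[h1 h2].
  by apply/(avoid_field _ (@coord_vanish_closed w) fK)/h1.
by apply: contrapT => /h2.
Qed.

(** The values taken by the coordinate [w] on L form an ideal. Were it proper, the coordinate would
    vanish over the quotient. *)
Lemma avoid_coord A (L : proj_space k W A) w :
  avoid (coord_vanish w) L -> exists2 u, proj1_sig L u & u w = 1.
Proof.
case: L => L pL av; apply: contrapT => no1.
have [[L0 LD LZ] _ _] := pL.
pose I a := exists2 u, L u & u w = a.
have idI : ideal I.
  split=> [|_ _ [u Lu <-] [v Lv <-]|a _ [u Lu <-]].
  - by exists 0; rewrite ?ffunE.
  - by exists (u + v); rewrite ?ffunE //; apply: LD.
  - by exists [ffun w => a * u w]; rewrite ?ffunE //; apply: LZ.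
have [Q [p [_ p0]]] := quotient_exists idI no1.
apply: (av Q p) => v /=.
have sub0 : submodule (fun v : {ffun W -> Q} => v w = 0).
  split=> [|a b a0 b0|a b b0]; rewrite !ffunE //.
    by rewrite a0 b0 addr0.
  by rewrite b0 mulr0.
move/(_ _ sub0); apply => _ [u Lu ->]; rewrite ffunE.
by apply/p0; exists u.
Qed.

(** * The torus of lines with a given support *)

Section TorusEmbedding.
Variable (S : {set W}) (w0 : W).
Hypothesis Sw0 : w0 \in S.

Let n := #|S|.-1.
Let at_ i := nth w0 (enum S) i.

Let size_S : #|S| = n.+1.
Proof. by rewrite prednK // (cardD1 w0) Sw0. Qed.

Let base := at_ 0.

Let base_S : base \in S.
Proof. by rewrite -mem_enum mem_nth // -cardE size_S. Qed.

Let index_base : index base (enum S) = 0%N.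
Proof. by rewrite index_uniq ?enum_uniq // -cardE size_S. Qed.

(** Homogeneous coordinates are normalised to 1 at [base], the first element of [enum S]; hence one
    variable fewer than |S| and the shift of indices by one. *)
Let vec A (g : {lrmorphism laurent k n -> A}) : {ffun W -> A} :=
  [ffun w => if w \in S then
     (if index w (enum S) is i.+1 then g (@laurent_var k n i) else 1) else 0].

Let vec_base A (g : {lrmorphism laurent k n -> A}) : vec g base = 1.
Proof. by rewrite ffunE base_S index_base. Qed.

Let vec_at A (g : {lrmorphism laurent k n -> A}) i : (i < n)%N ->
  vec g (at_ i.+1) = g (@laurent_var k n i).
Proof.
move=> lt_in; have lti : (i.+1 < size (enum S))%N by rewrite -cardE size_S.
by rewrite ffunE index_uniq ?enum_uniq // -mem_enum mem_nth.
Qed.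

Let embed_fun A (g : torus k n A) : proj_space k W A :=
  exist _ (line (vec g)) (line_proj_point (vec_base g)).

Let embed_nat A B (f : {lrmorphism A -> B}) (g : torus k n A) :
  embed_fun (pmap f g) = pmap f (embed_fun g).
Proof.
apply: proj_eq; rewrite /= (extend_line f (vec_base g)); congr line.
apply/ffunP => w; rewrite !ffunE; case: (w \in S); last by rewrite rmorph0.
by case: (index w _) => //; rewrite rmorph1.
Qed.

Let embed : morphism (torus k n) (proj_space k W) := Morphism embed_nat.

(** Conversely, a point of the stratum has a generator with coordinate 1 at [base]. Its other
    coordinates in [S] are units, since some multiple takes the value 1 there, so they define a
    morphism from the Laurent algebra. *)
Let embed_image A (L : proj_space k W A) : in_image embed L <-> stratum S L.
Proof.
have [fgR tU lift epi] := laurentP k n; split=> [[g <-]|/stratumE SL].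
  apply/stratumE => w; case: ifP => [wS|wS]; last first.
    by move=> _ [a ->]; rewrite !ffunE wS mulr0.
  move=> B f /(_ (map_vec f (vec g))); rewrite /= (extend_line f (vec_base g)).
  move/(_ (line_self _)); rewrite ffunE; apply: unit_neq0.
  rewrite ffunE wS; case E: (index w _) => [|i]; first by exists 1; rewrite mulr1.
  have [|b tb] := tU i; last by exists (g b); rewrite -rmorphM tb rmorph1.
  by rewrite -ltnS -E -size_S cardE index_mem mem_enum.
have inv w : w \in S -> exists2 u, proj1_sig L u & u w = 1.
  by move=> wS; have := SL w; rewrite wS; apply: avoid_coord.
have [u Lu u1] := inv _ base_S.
have LE := proj_point_line (proj2_sig L) Lu u1.
have uU w : w \in S -> exists b, u w * b = 1.
  case/inv => v; rewrite LE => -[a ->]; rewrite ffunE => au.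
  by exists a; rewrite mulrC.
have [|g gE] := lift A (fun i => u (at_ i.+1)).
  move=> i lt_in; apply: uU; rewrite -mem_enum mem_nth // -cardE size_S.
  by rewrite ltnS.
exists g; apply: proj_eq; rewrite /= LE; congr line; apply/ffunP => w.
rewrite ffunE; case: ifPn => wS; last first.
  by have := SL w; rewrite (negPf wS) => /(_ u Lu).
have wE : w \in enum S by rewrite mem_enum.
have := nth_index w0 wE; case E: (index w _) => [|i] <-; first by rewrite u1.
by apply: gE; rewrite -ltnS -E -size_S cardE index_mem.
Qed.

Lemma torus_embedding : exists t : morphism (torus k #|S|.-1) (proj_space k W),
  immersion t /\ forall A (L : proj_space k W A), in_image t L <-> stratum S L.
Proof.
exists embed; split=> //; split=> [A g h /(congr1 (@proj1_sig _ _)) /= E|A L].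
  have [_ _ _ epi] := laurentP k n.
  apply: lrmorphism_ext; apply: epi => i lt_in.
  by rewrite -!vec_at // (line_inj (vec_base g) (vec_base h) E).
have [I [J IJ]] := stratum_locally_closed S L; exists I, J => B f.
by rewrite embed_image.
Qed.

End TorusEmbedding.

(** * Independence of the partition *)

Section Constructible.
Variables (SS : {set {set W}}) (C : point_set (proj_space k W)).
Hypothesis SS0 : set0 \notin SS.
Hypothesis CE : forall K (L : proj_space k W K), is_field_alg K ->
  C L <-> exists2 S, S \in SS & stratum S L.

Let torus_of S : S \in SS -> exists t : morphism (torus k #|S|.-1) (proj_space k W),
  immersion t /\ forall A (L : proj_space k W A), in_image t L <-> stratum S L.
Proof.
move=> SSS; have [S0|[w Sw]] := set_0Vmem S; first by case/negP: SS0; rewrite -S0.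
exact: (torus_embedding Sw).
Qed.

(** Without a first partition, the choice made by [constructible_class] would carry no
    information. *)
Lemma strata_class_exists : exists a, has_class C a.
Proof.
pose S_ (j : 'I_#|SS|) := enum_val j.
have ex j := cid (torus_of (enum_valP j)).
exists (\big[@K0_add k/K0_zero]_(j < #|SS|) K0_class (torus k #|S_ j|.-1)).
exists #|SS|, (fun j => torus k #|S_ j|.-1), (fun j => proj1_sig (ex j)).
have imE j A (L : proj_space k W A) : in_image (proj1_sig (ex j)) L <-> stratum (S_ j) L.
  by case: (proj2_sig (ex j)).
split=> [j|K L fK|K L i j fK|]; last exact: K0_refl.
- by case: (proj2_sig (ex j)).
- rewrite CE //; split=> [[S SSS SL]|[j /imE jL]]; last by exists (S_ j) => //; apply: enum_valP.
  by exists (enum_rank_in SSS S); apply/imE; rewrite /S_ enum_rankK_in.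
- by move=> /imE iL /imE jL; apply: enum_val_inj; apply: stratum_unique iL jL.
Qed.

(** Both sums equal a double sum over the members [j] and the supports [S]: the part of [Z j] in the
    stratum of [S] and the part of the torus in [Z j] are the same fibre product, by
    [class_of_fiber]. *)
Lemma strata_class a : has_class C a ->
  K0_of a = \big[@K0_plus k/K0_0 k]_(S in SS) torus_class k #|S|.-1.
Proof.
case=> n [Z [i [immi cov disj]]] /K0_ofP ->; rewrite K0_of_sum.
pose c j S := class_of (fun A (z : Z j A) => stratum S (i j A z)).
have split_Z j : K0_of (K0_class (Z j)) = \big[@K0_plus k/K0_0 k]_(S in SS) c j S.
  rewrite -class_of_full (@class_of_partition k (Z j) _ (enum {set W})
    (fun S A z => stratum S (i j A z))).
  - rewrite big_enum /= [RHS]big_mkcond /=; apply: eq_bigr => S _.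
    have -> : point_inter (fun A (x : Z j A) => True) (fun A z => stratum S (i j A z)) =
        (fun A z => stratum S (i j A z)).
      by apply: point_set_ext => A x; split=> [[]|].
    (* Strata outside [SS] meet [Z j] in no field-valued point, since the image of [Z j] lies in
       [C]. *)
    case: ifPn => // nSS; apply: class_of_empty => [|K z fK SL].
      exact/pullback_locally_closed/stratum_locally_closed.
    have /CE[//|S' S'SS S'L] : C (i j K z) by apply/cov => //; exists j, z.
    by rewrite (stratum_unique SL S'L) S'SS in nSS.
  - by apply: closed_locally_closed => A x; exists [::].
  - exact: enum_uniq.
  - move=> S _; split; last exact: stratum_pullback_cut.
    exact/pullback_locally_closed/stratum_locally_closed.
  - move=> K z fK _; exists [set w | `[< coord_nonzero (i j K z) w >]].
      by rewrite mem_enum.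
    by apply/stratum_field => // w; rewrite inE; split=> /asboolP.
  - by move=> K z S S' fK _ _ _; apply: stratum_unique.
rewrite (eq_bigr _ (fun j _ => split_Z j)) exchange_big /=.
apply: eq_bigr => S SSS; have [t [immt tE]] := torus_of SSS.
rewrite /torus_class -class_of_full.
rewrite (@class_of_partition k (torus k #|S|.-1) _ (enum 'I_n)
  (fun j A y => in_image (i j) (t A y))).
- rewrite big_enum /=; apply: eq_bigr => j _.
  have -> : point_inter (fun A (x : torus k #|S|.-1 A) => True)
      (fun A y => in_image (i j) (t A y)) = (fun A y => in_image (i j) (t A y)).
    by apply: point_set_ext => A x; split=> [[]|].
  rewrite -(class_of_fiber (immi j) immt); congr class_of.
  by apply: point_set_ext => A z; rewrite tE.
- by apply: closed_locally_closed => A x; exists [::].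
- exact: enum_uniq.
- move=> j _; have lcj : locally_closed (fun A y => in_image (i j) (t A y)).
    exact/pullback_locally_closed/image_locally_closed.
  by split=> //; apply: cut_spec.
- move=> K y fK _; have /cov[//|j jL] : C (t K y).
    by apply/CE => //; exists S => //; apply/tE; exists y.
  by exists j => //; rewrite mem_enum.
- by move=> K y j j' fK _ _ _; apply: disj.
Qed.

End Constructible.
End Lines.

(** * Supports of the points of a loose graph *)

Section Supports.
Variable G : loose_graph.

Definition near (v : vert G) (w : vert (completion G)) : bool :=
  (w == inl v) || [exists e, inc v e && completion_inc w e].

Definition star_support (S : {set vert (completion G)}) : bool :=
  [exists v : vert G, (inl v \in S) && [forall w in S, near v w]].

Definition edge_support (S : {set vert (completion G)}) : bool :=
  [exists e : edge G, (ends e == set0) && (S == [set w | completion_inc w e])].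

Definition supports : {set {set vert (completion G)}} :=
  [set S | star_support S || edge_support S].

Lemma star_supportP (S : {set vert (completion G)}) :
  reflect (exists2 v : vert G, inl v \in S & forall w, w \in S -> near v w)
          (star_support S).
Proof.
apply: (iffP existsP) => [[v /andP[vS /forall_inP nS]]|[v vS nS]]; exists v => //.
by rewrite vS; apply/forall_inP.
Qed.

Lemma edge_supportP (S : {set vert (completion G)}) :
  reflect (exists2 e : edge G, ends e = set0 & forall w, (w \in S) = completion_inc w e)
          (edge_support S).
Proof.
apply: (iffP existsP) => [[e /andP[/eqP e0 /eqP ->]]|[e e0 SE]]; exists e => //.
  by move=> w; rewrite inE.
by rewrite e0 eqxx; apply/eqP/setP => w; rewrite SE inE.
Qed.

Lemma near_adj (v : vert G) (w : vert (completion G)) :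
  near v w = (w == old_vert v) || adj (old_vert v) w.
Proof. by rewrite /near /adj eq_sym; case: eqVneq. Qed.

(** An edge without vertices has an added end. This makes its support nonempty, and later places it
    outside every hull. *)
Lemma edge_support_new (S : {set vert (completion G)}) (e : edge G) :
    ends e = set0 -> (forall w, (w \in S) = completion_inc w e) ->
  exists2 p : new_vert G, inr p \in S & (val p).1 = e.
Proof.
move=> e0 SE; have pP : (#|ends (e, ord0 : 'I_2).1| + (e, ord0 : 'I_2).2 < 2)%N.
  by rewrite /= e0 cards0.
exists (exist _ (e, ord0) pP : new_vert G); rewrite ?SE //.
by rewrite /completion_inc /=.
Qed.

Lemma supports0 : set0 \notin supports.
Proof.
rewrite inE; apply/norP; split.
  by apply/star_supportP => -[v]; rewrite inE.
apply/edge_supportP => -[e e0 SE].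
by have [p] := edge_support_new e0 SE; rewrite inE.
Qed.

Lemma F_points_strata (k : fieldType) (K : comAlgType k) (L : ambient k G K) :
  is_field_alg K ->
  F_points L <-> exists2 S, S \in supports & stratum S L.
Proof.
move=> fK; split=> [|[S]].
  move=> FL; exists [set w | `[< coord_nonzero L w >]]; last first.
    by apply/stratum_field => // w; rewrite inE; split=> /asboolP.
  rewrite inE; case: FL => [[v [Lv L0]]|[e e0 Le]].
    apply/orP; left; apply/star_supportP; exists v; first by rewrite inE; apply/asboolP.
    move=> w; rewrite inE near_adj => /asboolP Lw.
    by case: eqVneq => //= neq; apply: contrapT => /negP nadj; apply/Lw/L0.
  apply/orP; right; apply/edge_supportP; exists e => // w; rewrite inE.
  have : if completion_inc w e then coord_nonzero L w else coord_zero L w := Le w.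
  by case: ifP => _ h; [apply/asboolP | apply/asboolP => /(_ h)].
rewrite inE => /orP[/star_supportP[v vS nS]|/edge_supportP[e e0 SE]] /stratum_field-/(_ fK) SL.
  left; exists v; split=> [|w neq nadj]; first by apply/SL.
  apply: contrapT => /SL /nS; rewrite near_adj => /orP[/eqP E|adjw].
    by rewrite E eqxx in neq.
  by rewrite adjw in nadj.
right; exists e => // w; change (inc w _) with (completion_inc w e); rewrite -SE.
by case: ifPn => [/SL//|/negP nS]; apply: contrapT => /SL.
Qed.

Lemma grothendieck_supports (k : fieldType) :
  K0_of (grothendieck k G) =
  \big[@K0_plus k/K0_0 k]_(S in supports) torus_class k #|S|.-1.
Proof.
apply: (strata_class supports0 (C := @F_points k G)) => [K L fK|].
  exact: F_points_strata.
apply: epsilon_spec; apply: (strata_class_exists supports0) => K L fK.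
exact: F_points_strata.
Qed.

End Supports.

Arguments supports : clear implicits.

(** Both comparisons of graphs transport supports along an injection of completed vertices, and the
    class of a torus depends only on the size of its support. *)
Lemma big_set_transfer (R : Type) (idx : R) (op : Monoid.com_law idx) (T T' : finType)
    (f : T -> T') (D : {set {set T}}) (D' : {set {set T'}}) (F : nat -> R) :
    injective f -> (forall S : {set T}, (S \in D) = (f @: S \in D')) ->
    (forall S, S \in D' -> S \subset f @: setT) ->
  \big[op/idx]_(S in D) F #|S| = \big[op/idx]_(S in D') F #|S|.
Proof.
move=> injf DE imD'.
have D'E : D' = [set f @: S | S : {set T} in D].
  apply/setP => S'; apply/idP/imsetP => [S'D'|[S SD ->]]; last by rewrite -DE.
  have S'E : S' = f @: (f @^-1: S').
    apply/setP => w'; apply/idP/imsetP => [w'S|[w]]; last by rewrite inE => ? ->.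
    have /imsetP[w _ w'E] := subsetP (imD' _ S'D') _ w'S.
    by exists w => //; rewrite inE -w'E.
  by exists (f @^-1: S') => //; rewrite DE -S'E.
rewrite D'E big_imset /=; last by move=> S S' _ _; apply: imset_inj.
by apply: eq_bigr => S _; rewrite card_imset.
Qed.

(** * Supports of an induced loose graph *)

Section Induced.
Variables (G : loose_graph) (P : {set vert G}).

Let H := induced P.

(** The coordinates of the completion of [induced P], read in the completion of [G]. Containment of
    a support in the projective space generated by [P] means containment in this set, which includes
    the added ends of the retained edges. *)
Definition hull : {set vert (completion G)} :=
  [set w : vert (completion G) | match w with
    | inl v => v \in P
    | inr p => (ends (val p).1 != set0) && (ends (val p).1 \subset P)
    end].

Lemma ends_induced (e : edge H) : val @: ends e = ends (val e).
Proof.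
have /andP[_ /subsetP eP] := valP e.
apply/setP => v; apply/imsetP/idP => [[w]|ve]; first by rewrite !inE => we ->.
by exists (Sub v (eP v ve)); rewrite ?SubK // inE /= /induced_inc SubK; rewrite inE in ve.
Qed.

Lemma card_ends_induced (e : edge H) : #|ends e| = #|ends (val e)|.
Proof. by rewrite -ends_induced card_imset //; apply: val_inj. Qed.

(** A retained edge keeps all its vertices, so it receives as many new ones in either completion. *)
Definition induced_vert (w : vert (completion H)) : vert (completion G) :=
  match w with
  | inl v => inl (val v)
  | inr p => inr (exist _ (val (val p).1, (val p).2)
      (etrans (congr1 (fun n => n + (val p).2 < 2)%N (esym (card_ends_induced (val p).1)))
         (valP p)))
  end.

Lemma induced_vert_inj : injective induced_vert.
Proof.
move=> [v|p] [w|q] //= [].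
  by move=> /val_inj ->.
move=> e1 e2; congr inr; apply: val_inj.
by rewrite [LHS]surjective_pairing [RHS]surjective_pairing (val_inj e1) e2.
Qed.

Lemma induced_vert_image : induced_vert @: setT = hull.
Proof.
apply/setP => -[v|p]; rewrite inE; apply/imsetP/idP => [[[w|q] _ //=]|].
- by move=> [->]; apply: (proj2_sig w).
- by move=> vP; exists (inl (Sub v vP)); rewrite ?inE //=.
- by move=> [->] /=; apply: (proj2_sig (val q).1).
- move=> pP; pose e : edge H := Sub (val p).1 pP.
  have eP : (#|ends (e, (val p).2).1| + (e, (val p).2).2 < 2)%N.
    by rewrite card_ends_induced; apply: (valP p).
  exists (inr (Sub (e, (val p).2) eP)); rewrite ?inE //=; congr inr; apply: val_inj => /=.
  by rewrite [LHS]surjective_pairing.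
Qed.

Lemma completion_inc_induced (w : vert (completion H)) (e : edge H) :
  completion_inc (induced_vert w) (val e) = completion_inc w e.
Proof. by case: w => [v|p] //=. Qed.

(** An edge joining two vertices of [P] has no further vertex, so it is retained; an added end in
    the completion of [H] already belongs to a retained edge. *)
Lemma near_induced (v : vert H) (w : vert (completion H)) :
  near (val v) (induced_vert w) = near v w.
Proof.
rewrite /near -(inj_eq induced_vert_inj) /=.
case: eqVneq => //= neq; apply/existsP/existsP => -[e /andP[ve we]]; last first.
  by exists (val e); rewrite completion_inc_induced; apply/andP.
have [e' e'E] : exists e' : edge H, val e' = e.
  case: w neq we => [w|p] /= neq we; last by exists (val p).1; apply/eqP.
  suff eP : (ends e != set0) && (ends e \subset P) by exists (Sub e eP).
  have vw : val v != val w by apply: contraNneq neq => ->.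
  have sub2 : [set val v; val w] \subset ends e.
    by rewrite subUset !sub1set !inE ve we.
  have -> : ends e = [set val v; val w].
    by apply/esym/eqP; rewrite eqEcard sub2 cards2 vw; apply: inc_le2.
  rewrite subUset !sub1set (proj2_sig v) (proj2_sig w) !andbT.
  by apply/set0Pn; exists (val v); rewrite !inE eqxx.
by exists e'; rewrite -completion_inc_induced e'E we andbT /= /induced_inc e'E.
Qed.

Lemma edge_support_induced (S : {set vert (completion G)}) :
  edge_support S -> ~~ (S \subset hull).
Proof.
case/edge_supportP => e e0 SE; have [p pS pE] := edge_support_new e0 SE.
by apply/negP => /subsetP/(_ _ pS); rewrite inE pE e0 eqxx.
Qed.

Lemma no_edge_support (S : {set vert (completion H)}) : ~~ edge_support S.
Proof.
apply/edge_supportP => -[e e0 _]; have /andP[/negP nz _] := valP e; apply: nz.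
by rewrite -cards_eq0 -card_ends_induced e0 cards0.
Qed.

Lemma supports_induced (R : Type) (idx : R) (op : Monoid.com_law idx) (F : nat -> R) :
  \big[op/idx]_(S in supports H) F #|S| =
  \big[op/idx]_(S in [set S in supports G | S \subset hull]) F #|S|.
Proof.
apply: (big_set_transfer _ _ induced_vert_inj) => [S|S]; last first.
  by rewrite induced_vert_image !inE => /andP[].
have imS : induced_vert @: S \subset hull by rewrite -induced_vert_image imsetS ?subsetT.
rewrite !inE imS andbT (negPf (no_edge_support S)) orbF.
have /negPf -> : ~~ edge_support (induced_vert @: S).
  by apply: contraTN imS; apply: edge_support_induced.
rewrite orbF; apply/star_supportP/star_supportP => -[v vS nS].
  exists (val v); first by apply/imsetP; exists (inl v).
  by move=> _ /imsetP[w wS ->]; rewrite near_induced nS.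
have /imsetP[[v' v'S [vE]|//]] := vS.
exists v' => // w wS; subst v.
exact: etrans (esym (near_induced v' w)) (nS _ (imset_f _ wS)).
Qed.

End Induced.

(** * Supports under the resolution of an edge *)

Section Resolution.
Variables (G : loose_graph) (xy : edge G) (x y : vert G).
Hypotheses (neq_xy : x != y) (inc_x : inc x xy) (inc_y : inc y xy).
Variable P : {set vert G}.
Hypotheses (Px : x \in P) (Py : y \in P)
  (Pnear : forall v, adj x v || adj y v -> v \in P).

Let G' := resolve xy x y.

Lemma ends_xy : ends xy = [set x; y].
Proof.
apply/esym/eqP; rewrite eqEcard subUset !sub1set !inE inc_x inc_y /=.
by rewrite cards2 neq_xy; apply: inc_le2.
Qed.

Lemma ends_resolve (e : {e : edge G | e != xy}) : ends (inl e : edge G') = ends (val e).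
Proof. by apply/setP => v; rewrite !inE. Qed.

Lemma new_vert_neq (p : new_vert G) : (val p).1 != xy.
Proof.
have := valP p; apply: contraTneq => ->.
by rewrite ends_xy cards2 neq_xy -leqNgt leq_addr.
Qed.

(** The edge [xy] has two vertices and so no added end: every added vertex of [G] belongs to an edge
    that survives. The completion of [G'] gains only the added ends of the two loose edges. *)
Definition resolve_vert (w : vert (completion G)) : vert (completion G') :=
  match w with
  | inl v => inl v
  | inr p => inr (exist _ (inl (exist _ (val p).1 (new_vert_neq p)), (val p).2)
      (etrans (congr1 (fun s : {set vert G} => #|s| + (val p).2 < 2)%N
        (ends_resolve (exist _ (val p).1 (new_vert_neq p)))) (valP p)))
  end.

Lemma resolve_vert_inj : injective resolve_vert.
Proof.
move=> [v|p] [w|q] //= []; first by move=> ->.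
move=> e1 e2; congr inr; apply: val_inj.
by rewrite [LHS]surjective_pairing [RHS]surjective_pairing e1 e2.
Qed.

Lemma resolve_vertP (w : vert (completion G')) :
  (exists w0, w = resolve_vert w0) \/
  exists (p : new_vert G') b, w = inr p /\ (val p).1 = inr b.
Proof.
case: w => [v|p]; first by left; exists (inl v).
case E: (val p).1 => [e|b]; last by right; exists p, b.
left; have eP : (#|ends (val e, (val p).2).1| + (val e, (val p).2).2 < 2)%N.
  by rewrite -ends_resolve -E; apply: (valP p).
exists (inr (Sub (val e, (val p).2) eP)); congr inr; apply: val_inj => /=.
by rewrite [LHS]surjective_pairing E; congr (inl _, _); apply: val_inj.
Qed.

Lemma resolve_vert_old (p : new_vert G') b w : (val p).1 = inr b -> inr p <> resolve_vert w.
Proof. by case: w => [v|q] //= pE [E]; rewrite E in pE. Qed.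

Lemma completion_inc_resolve (w : vert (completion G)) (e : {e : edge G | e != xy}) :
  completion_inc (resolve_vert w) (inl e) = completion_inc w (val e).
Proof. by case: w => [v|p] //=. Qed.

Lemma hull_resolve w : (resolve_vert w \in hull (P : {set vert G'})) = (w \in hull P).
Proof. by case: w => [v|p]; rewrite !inE //= ends_resolve. Qed.

(** A vertex adjacent to [x] or [y] is in [P] by [Pnear]; an added end near [x] or [y] belongs to a
    loose edge having that vertex only. *)
Lemma near_hull v w : (v == x) || (v == y) -> near v w -> w \in hull P.
Proof.
move=> vxy; have vP : v \in P by case/orP: vxy => /eqP ->.
rewrite /near; case: eqVneq => [-> _|neq /= /existsP[e /andP[ve]]]; first by rewrite inE.
case: w neq => [w|p] neq we; rewrite inE.
  apply: Pnear; have vw : v != w by apply: contraNneq neq => ->.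
  have : adj v w by rewrite /adj vw; apply/existsP; exists e; rewrite ve.
  by case/orP: vxy => /eqP -> ->; rewrite ?orbT.
have /eqP -> := we; have ev : v \in ends e by rewrite inE.
(* An edge with an added end has at most one vertex. *)
have -> : ends e = [set v].
  apply/esym/eqP; rewrite eqEcard sub1set ev cards1.
  by have := valP p; rewrite (eqP we) ltnS; apply: leq_trans; apply: leq_addr.
by rewrite sub1set vP andbT; apply/set0Pn; exists v; rewrite inE.
Qed.

(** Neither [xy] nor the two new loose edges are incident with a vertex other than [x] and [y]. *)
Lemma near_resolve v w : v != x -> v != y -> near (v : vert G') (resolve_vert w) = near v w.
Proof.
move=> vx vy; rewrite /near -(inj_eq resolve_vert_inj).
case: eqVneq => //= _; apply/existsP/existsP => -[e /andP[ve we]].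
  case: e ve we => [e|b] /=; last by case: b => /eqP E; rewrite E eqxx in vx vy.
  by rewrite completion_inc_resolve => ve we; exists (val e); rewrite ve.
have exy : e != xy.
  apply: contraTneq ve => ->; have := congr1 (fun s : {set vert G} => v \in s) ends_xy.
  rewrite !inE => ->.
  by rewrite (negPf vx) (negPf vy).
by exists (inl (Sub e exy)); rewrite completion_inc_resolve /= ve.
Qed.

Lemma near_resolve_new v (p : new_vert G') b : v != x -> v != y ->
  (val p).1 = inr b -> ~~ near (v : vert G') (inr p).
Proof.
move=> vx vy pE; apply/norP; split=> //.
apply/existsPn => e; apply/negP => /= /andP[ve /eqP eE].
by move: ve; rewrite -eE pE /=; case: b {pE} => /eqP E; rewrite E eqxx in vx vy.
Qed.

Lemma near_resolve_hull v w : (v == x) || (v == y) -> near (v : vert G') w ->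
  w \in hull (P : {set vert G'}).
Proof.
move=> vxy; have [[w0 ->]|[p [b [-> pE]]] _] := resolve_vertP w.
  rewrite hull_resolve => /orP[/eqP E|/existsP[[e|b] /andP[ve we]]].
  - by apply: (near_hull vxy); rewrite /near -(inj_eq resolve_vert_inj) E eqxx.
  - apply: (near_hull vxy); rewrite /near; apply/orP; right; apply/existsP.
    by exists (val e); rewrite completion_inc_resolve in we; rewrite we andbT.
  - case: w0 we => [w0|//] /= /eqP ->; rewrite inE.
    by case: b {ve}.
rewrite inE pE.
have -> : ends (inr b : edge G') = [set (if b then x else y)].
  by apply/setP => z; rewrite !inE.
rewrite sub1set; apply/andP; split; last by case: b {pE}.
by apply/set0Pn; exists (if b then x else y); rewrite inE.
Qed.

Lemma supports_resolve (R : Type) (idx : R) (op : Monoid.com_law idx) (F : nat -> R) :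
  \big[op/idx]_(S in [set S in supports G | ~~ (S \subset hull P)]) F #|S| =
  \big[op/idx]_(S in [set S in supports G' | ~~ (S \subset hull (P : {set vert G'}))]) F #|S|.
Proof.
have off (S : {set vert (completion G)}) v : ~~ (S \subset hull P) ->
    (forall w, w \in S -> near v w) -> v != x /\ v != y.
  move=> nS vS; apply/andP; rewrite -negb_or; apply: contra nS => vxy.
  by apply/subsetP => w /vS; apply: near_hull.
have off' (S : {set vert (completion G')}) (v : vert G') :
    ~~ (S \subset hull (P : {set vert G'})) ->
    (forall w, w \in S -> near v w) -> v != x /\ v != y.
  move=> nS vS; apply/andP; rewrite -negb_or; apply: contra nS => vxy.
  by apply/subsetP => w /vS; apply: near_resolve_hull.
(* The two new loose edges do have a vertex, so an edge of [G'] without vertices comes from [G]. *)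
have new_edge (S : {set vert (completion G')}) (e : edge G') : ends e = set0 ->
    exists e0, e = inl e0.
  case: e => [e0 _|b]; first by exists e0.
  move/(congr1 (fun s : {set vert G'} => (if b then x else y) \in s)).
  by rewrite !inE /= eqxx.
apply: (big_set_transfer _ _ resolve_vert_inj) => [S|S]; last first.
  rewrite inE => /andP[S_sup nS]; apply/subsetP => w wS.
  have [[w0 ->]|[p [b [wE pE]]]] := resolve_vertP w; first exact: imset_f.
  (* A support off the hull cannot contain the added end of a new loose edge: that end is near no
     centre other than [x] and [y], and is not an end of an edge without vertices. *)
  exfalso; move: S_sup; rewrite inE => /orP[/star_supportP[v vS vnear]|].
    have [vx vy] := off' _ _ nS vnear.
    by have := near_resolve_new vx vy pE; rewrite -wE vnear.
  case/edge_supportP => e /(new_edge S)[e0 ->] SE.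
  by have := SE w; rewrite wS wE /= pE.
have hullE : (resolve_vert @: S \subset hull (P : {set vert G'})) = (S \subset hull P).
  apply/subsetP/subsetP => sub w; last by case/imsetP => w0 /sub w0h ->; rewrite hull_resolve.
  by move=> wS; rewrite -hull_resolve; apply/sub/imset_f.
rewrite !inE hullE; case: (boolP (S \subset hull P)) => [|nS]; rewrite ?andbF ?andbT //.
have nS' := nS; rewrite -hullE in nS'.
congr (_ || _).
  apply/star_supportP/star_supportP => -[v vS vnear].
    exists v; first exact: (imset_f resolve_vert vS).
    have [vx vy] := off _ _ nS vnear.
    by move=> _ /imsetP[w wS ->]; rewrite near_resolve // vnear.
  have [vx vy] := off' _ _ nS' vnear.
  exists v; first by have /imsetP[[v' v'S [->]|//]] := vS.
  by move=> w wS; rewrite -near_resolve // vnear // imset_f.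
apply/edge_supportP/edge_supportP => -[e e0 SE].
  have exy : e != xy.
    apply: contra_eq_neq e0 => ->; apply/set0Pn; exists x; by rewrite inE.
  exists (inl (Sub e exy)); first by rewrite ends_resolve SubK.
  move=> w; have [[w0 ->]|[p [b [-> pE]]]] := resolve_vertP w.
    by rewrite mem_imset ?completion_inc_resolve ?SE //; apply: resolve_vert_inj.
  by rewrite /= pE; apply/imsetP => -[w0 _]; apply: resolve_vert_old pE.
have [e1 eE] := new_edge (resolve_vert @: S) e e0; subst e.
exists (val e1); first by rewrite -ends_resolve.
by move=> w; rewrite -completion_inc_resolve -SE mem_imset //; apply: resolve_vert_inj.
Qed.

End Resolution.

(** * Unit balls and the final cancellation *)

Lemma bigmin_leq (I : eqType) (r : seq I) (P : pred I) (F : I -> nat) m i :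
  i \in r -> P i -> (\big[minn/m]_(j <- r | P j) F j <= F i)%N.
Proof.
elim: r => // j r IHr; rewrite inE big_cons => /predU1P[<- ->|ir Pi].
  exact: geq_minl.
by case: ifP => _; [apply: leq_trans (geq_minr _ _) _ |]; apply: IHr.
Qed.

(** The bound on [size s] is the range of the minimum that defines [dist]. *)
Lemma dist_path (G : loose_graph) (c v : vert G) (s : seq (vert G)) :
  (size s < #|vert G|)%N -> path (@adj G) c s -> last c s = v -> (dist c v <= size s)%N.
Proof.
move=> lt_s cs sv; apply: (@bigmin_leq _ _ _ _ _ (Ordinal lt_s)) => /=.
  by rewrite mem_index_enum.
by apply/existsP; exists (in_tuple s); rewrite /= cs sv eqxx.
Qed.

Lemma Pxy_adj (G : loose_graph) (x y : vert G) : x != y ->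
  [/\ x \in Pxy G x y, y \in Pxy G x y
    & forall v, adj x v || adj y v -> v \in Pxy G x y].
Proof.
(* Two distinct vertices bring paths of length 1 into the range of lengths considered by [dist]. *)
move=> neq_xy; have V2 : (1 < #|vert G|)%N.
  by rewrite (cardD1 x) (cardD1 y) !inE eq_sym neq_xy.
have ball0 (c : vert G) : (dist c c <= 1)%N.
  exact: leq_trans (@dist_path G c c [::] (ltnW V2) isT erefl) (leqnSn 0).
have ball1 (c v : vert G) : adj c v -> (dist c v <= 1)%N.
  by move=> cv; apply: (dist_path (s := [:: v])) => //=; rewrite cv.
split=> [||v]; rewrite !inE ?ball0 ?orbT //.
by case/orP => /ball1 ->; rewrite ?orbT.
Qed.

Lemma K0_sub_shift (k : fieldType) (g g' h h' : K0_term k) (d : K0 k) :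
    K0_of g = K0_plus (K0_of h) d -> K0_of g' = K0_plus (K0_of h') d ->
  K0_eq (g - g')%K0 (h - h')%K0.
Proof.
(* Adding h' + d to both sides, which is also g', cancels g' on the left and h' on the right,
   leaving h + d on each side. *)
move=> gE g'E; apply/K0_ofP; apply: (@K0_plusI _ (K0_plus (K0_of h') d)).
rewrite !K0_of_add -{1}g'E gE.
have oppE a : K0_plus (K0_of a) (K0_of (- a)%K0) = K0_0 k.
  by rewrite K0_plusC -K0_of_add; apply/K0_ofP/K0_addN.
rewrite (K0_plusC _ (K0_of (- g')%K0)) K0_plusA oppE K0_plus0.
rewrite (K0_plusC (K0_of h')) -K0_plusA [in RHS](K0_plusC (K0_of h)) (K0_plusA (K0_of h')).
by rewrite oppE K0_plus0 K0_plusC.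
Qed.

Theorem corollary11p9 (k : finFieldType) (G : loose_graph) (xy : edge G)
    (x y : vert G) (connG : loose_connected G) (neq_xy : x != y)
    (inc_x : inc x xy) (inc_y : inc y xy) :
  (grothendieck k G - grothendieck k (resolve xy x y) =K0
   grothendieck k (induced (Pxy G x y))
     - grothendieck k (@induced (resolve xy x y) (Pxy G x y)))%K0.
Proof.
have [Px Py Padj] := Pxy_adj neq_xy.
(* Scaling a line costs one dimension: a support of size [n] gives a torus of dimension [n.-1]. *)
pose F n := torus_class k n.-1.
(* The supports outside the hull contribute the error term, which [supports_resolve] shows to be
   common to [G] and its resolution. *)
have split_supports (H : loose_graph) (P : {set vert H}) :
    K0_of (grothendieck k H) = K0_plus (K0_of (grothendieck k (induced P)))
      (\big[@K0_plus k/K0_0 k]_(S in [set S in supports H | ~~ (S \subset hull P)]) F #|S|).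
  rewrite !grothendieck_supports (supports_induced P (@K0_plus k) F).
  rewrite (bigID (fun S : {set vert (completion H)} => S \subset hull P)) /=.
  by congr K0_plus; apply: eq_bigl => S; rewrite !inE.
apply: K0_sub_shift (split_supports G _) _.
rewrite (supports_resolve neq_xy inc_x inc_y Px Py Padj (@K0_plus k) F).
exact: split_supports.
Qed.
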